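(* Let $q$ be a prime power, $F$ a field of characteristic $p>0$ not dividing $q$, and $m=m(p,q)$. Let $\beta^n_{k,i}=\dim_F H^n_{k,i}$. Let $(k,i)$ be a middle index for $n$. Then (i) if $n\ge1$, $\beta^n_{k,i}=\beta^{n-1}_{k,i+1}+\beta^{n-1}_{k-1,i-1}+\beta^{n-2}_{k-1,i}\,(q^{n-1}-1)$; (ii) $\beta^n_{k,i}=\sum_{t\in\mathbb{Z}}\left(\binom{n}{k+tm}_q-\binom{n}{k-i+tm}_q\right)$; in particular, $\beta^n_{k,i}$ is the Euler characteristic of the sequence $\mathcal{M}^n_{k,i}$; (iii) (Duality) for all $0\le\ell\le n$ and $0<j<m$ we have $\beta^n_{\ell,j}=\beta^n_{n-\ell,m-j}$; (iv) let $\epsilon=2$ when $n$ is odd and $\epsilon=1$ otherwise. Then as a polynomial in $q$ we have $$\beta^n_{k,i}=(q^{n-1}-1)(q^{n-3}-1)(q^{n-5}-1)\cdots(q^{\epsilon}-1)+f(q),$$ where $f(q)$ is a polynomial of degree $<(n-1)+(n-3)+(n-5)+\dots+\epsilon$.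
   Context: For $i\ge 1$ put $[i]_q=1+q+\dots+q^{i-1}$, and let $m=m(p,q):=\min\{i>1 : [i]_q=0 \text{ in } F\}$. For integers $n$ and $k$ let $L^n_k$ be the set of $k$-dimensional subspaces of $\mathbb{F}_q^n$ and let $M^n_k=FL^n_k$ be the $F$-vector space with basis $L^n_k$; $M^n_k=0$ if $k<0$ or $k>n$, and also if $n<0$. The $q$-binomial coefficient $\binom{n}{k}_q=|L^n_k|$ is the number of $k$-dimensional subspaces of $\mathbb{F}_q^n$ (zero if $k<0$ or $k>n$). The incidence map $\partial:M^n_k\to M^n_{k-1}$ is the linear map sending $x\in L^n_k$ to the sum of all $(k-1)$-dimensional subspaces of $x$. One has $\partial^m=0$. For $0<i<m$ define $$H^n_{k,i}:=(\ker\partial^i\cap M^n_k)\,/\,\partial^{m-i}(M^n_{k+m-i}),$$ and put $H^n_{k,0}=0=H^n_{k,m}$, so that $\beta^n_{k,0}=0=\beta^n_{k,m}$. For $0<i<m$, $\mathcal{M}^n_{k,i}$ is the homological sequence (chain complex) $$\cdots\leftarrow M^n_{k-m}\xleftarrow{\partial^{m-i}} M^n_{k-i}\xleftarrow{\partial^{i}} M^n_{k}\xleftarrow{\partial^{m-i}} M^n_{k+m-i}\xleftarrow{\partial^{i}} M^n_{k+m}\leftarrow\cdots .$$ A pair of integers $(k,i)$ is a middle index for $n$ if $0\le k\le n$, $0<i<m$ and $n<2k+m-i<n+m$.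
   Formalization: In (iv) the bound deg f < (n-1)+(n-3)+...+ε is stated only when |2k-n| ≤ 1; for other middle indices only ≤ is claimed, since the strict bound fails there (n=2, k=0, i=1, m=4 gives β=1, f=2-q). *)

(* Defs.v *)
From HB Require Import structures.
From mathcomp Require Import all_boot all_order all_algebra.
From mathcomp Require Import all_classical.
Set Implicit Arguments.
Unset Strict Implicit.
Unset Printing Implicit Defensive.
Import Order.TTheory GRing.Theory Num.Theory.
Import VectorInternalTheory.
Local Open Scope ring_scope.

(* Over a finite field, a subspace is a normalised matrix, so subspaces of a
   finite-dimensional space form a finite type. *)
HB.instance Definition _ (K : finFieldType) (vT : vectType K) :=
  [Countable of {vspace vT} by <:].
HB.instance Definition _ (K : finFieldType) (vT : vectType K) :=
  [Finite of {vspace vT} by <:].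

Definition qint (F : fieldType) (q i : nat) : F := \sum_(j < i) q%:R ^+ j.

(* m = min {i > 1 : [i]_q = 0 in F}; [is_min_qint_root_exists] below shows that
   this minimum exists when F has characteristic p > 0 not dividing q. *)
Definition is_min_qint_root (F : fieldType) (q m : nat) : Prop :=
  [/\ (1 < m)%N, qint F q m = 0 &
      forall i : nat, (1 < i < m)%N -> qint F q i <> 0].

Lemma is_min_qint_root_exists (F : fieldType) (p q : nat) :
  p \in [pchar F] -> ~~ (p %| q)%N -> exists m, is_min_qint_root F q m.
Proof.
move=> pF; rewrite (dvdn_pcharf pF) => q0.
have p_pr : prime p by apply: pcharf_prime pF.
have : exists j, (1 < j)%N && (qint F q j == 0).
  have [q1|q1] := eqVneq (q%:R : F) 1.
    exists p; rewrite prime_gt1 //= /qint q1.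
    under eq_bigr do rewrite expr1n.
    by rewrite sumr_const card_ord (pcharf0 pF).
  have Fq : (q%:R : F) ^+ p.-1 = 1.
    apply: (mulfI q0); rewrite -exprS prednK ?prime_gt0 // mulr1.
    by have := pFrobenius_aut_nat pF q; rewrite pFrobenius_autE.
  exists p.-1; apply/andP; split.
    have := prime_gt1 p_pr; case: (p) Fq => [|[|[|r]]] //=.
    by rewrite expr1 => Fq; rewrite Fq eqxx in q1.
  have /esym/eqP := subrX1 (q%:R : F) p.-1.
  by rewrite Fq subrr mulf_eq0 subr_eq0 (negPf q1).
case/ex_minnP => m /andP[m1 /eqP m0] mmin; exists m; split=> // j /andP[j1 jm].
by move/eqP=> j0; move: (mmin j); rewrite j1 j0 leqNgt jm => /(_ isT).
Qed.

Definition middle_index (m : nat) (n k : int) (i : nat) : Prop :=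
  [/\ 0 <= k <= n, (0 < i < m)%N & n < k *+ 2 + m%:Z - i%:Z < n + m%:Z].

Section IncidenceModules.
Variables (K : finFieldType) (F : fieldType) (n : int).

(* For n < 0 the ambient type is a dummy: [Lset k] is then empty and
   [Mod k] is zero. *)
Definition subsp := {vspace 'rV[K]_`|n|}.

Definition Lset (k : int) : {set subsp} :=
  [set U : subsp | (0 <= n) && ((\dim U)%:Z == k)].

(* The q-binomial coefficient, for q = #|K|. *)
Definition qbinom (k : int) : nat := #|Lset k|.

(* The direct sum of all the M^n_k; M^n_k itself is the subspace [Mod k], so
   that the incidence map and its powers are endomorphisms of one space. *)
Definition chains := {ffun subsp -> F^o}.

Definition basis_vec (x : subsp) : chains := [ffun y => (y == x)%:R].

Definition Mod (k : int) : {vspace chains} :=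
  <<[seq basis_vec x | x in Lset k]>>%VS.

Definition faces (x : subsp) : chains :=
  \sum_(y : subsp | (y <= x)%VS && ((\dim y).+1 == \dim x)) basis_vec y.

Definition incidence_fun (f : chains) : chains :=
  \sum_(x : subsp) f x *: faces x.

Lemma incidence_fun_linear : linear incidence_fun.
Proof.
move=> a f g; rewrite /incidence_fun scaler_sumr -big_split /=.
by apply: eq_bigr => x _; rewrite !ffunE scalerDl scalerA.
Qed.

HB.instance Definition _ :=
  GRing.isLinear.Build F chains chains _ incidence_fun incidence_fun_linear.

Definition incidence : 'End(chains) := linfun incidence_fun.

Lemma incidence_basis (x : subsp) : incidence (basis_vec x) = faces x.
Proof.
rewrite lfunE /= /incidence_fun (bigD1 x) //= ffunE eqxx scale1r big1 ?addr0//.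
by move=> y /negPf yx; rewrite ffunE yx scale0r.
Qed.

Definition incidence_pow (j : nat) : 'End(chains) :=
  iter j (fun g => (incidence \o g)%VF) \1%VF.

Definition cycles (k : int) (i : nat) : {vspace chains} :=
  (lker (incidence_pow i) :&: Mod k)%VS.

Definition boundaries (m : nat) (k : int) (i : nat) : {vspace chains} :=
  (incidence_pow (m - i) @: Mod (k + m%:Z - i%:Z))%VS.

(* The quotient of cycles by boundaries, realised as the complement of the
   boundaries in the cycles. *)
Definition homology (m : nat) (k : int) (i : nat) : {vspace chains} :=
  if (0 < i < m)%N then (cycles k i :\: boundaries m k i)%VS else 0%VS.

Definition betti (m : nat) (k : int) (i : nat) : nat := \dim (homology m k i).

(* [arrow s] is the map from [term s] to [term (s - 1)]. *)
Record homseq := HomSeq {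
  term : int -> {vspace chains};
  arrow : int -> 'End(chains) }.

Definition euler_char (C : homseq) : int :=
  \sum_(s \in [set: int]) (-1) ^+ `|s|%N * (\dim (term C s))%:Z.

(* The terms in positions -2, -1, 0, 1, 2 are the M^n_j with
   j = k - m, k - i, k, k + m - i, k + m. *)
Definition seqM (m : nat) (k : int) (i : nat) : homseq := HomSeq
  (fun s : int => Mod (k + (s %/ 2)%Z * m%:Z
                       + (if (2 %| s)%Z then 0 else m%:Z - i%:Z)))
  (fun s : int => incidence_pow (if (2 %| s)%Z then i else m - i)%N).

End IncidenceModules.

Definition lead_eps (n : nat) : nat := if odd n then 2 else 1.

(* The exponents n - 1, n - 3, ..., [lead_eps n].  Their sum is floor(n^2 / 4).
   At a middle index the Betti number has degree k (n - k) in q, which equals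
   this sum exactly when |2k - n| <= 1.  If |2k - n| > 1 (possible when m > 3),
   the remainder f must cancel the product's leading term: for n = 2, k = 0,
   i = 1, m = 4 the Betti number is 1, so f = 2 - q. *)
Definition lead_exps (n : nat) : seq nat :=
  [seq e <- index_iota (lead_eps n) n | odd e != odd n].

(* Main.v *)
Require Import Defs.
From HB Require Import structures.
From mathcomp Require Import all_boot all_order all_algebra.
From mathcomp Require Import all_classical.
From mathcomp Require Import zify.
Set Implicit Arguments.
Unset Strict Implicit.
Unset Printing Implicit Defensive.
Import Order.TTheory GRing.Theory Num.Theory.
Local Open Scope ring_scope.

(* Embed W = K^(n-1) as a hyperplane of V = K^n, and write a subspace of V not in
   W as a flat (A, w + A), where A is its intersection with W and w + A is a
   coset.  For v in W, v != 0, and phi : K -> F of total sum 0, the chains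
   supported on flats and weighted by phi(v.w), over the A inside the hyperplane
   v^perp of W, form a subcomplex isomorphic to the chains of K^(n-2).  For a
   suitable phi these q^(n-1) - 1 subcomplexes, together with the chains of W and
   the cones over them, give a direct sum decomposition of the chains of V
   (Fourier analysis on W without roots of unity).  On the part generated by W
   the j-th power of the incidence map is [[d^j, [j] d^(j-1)], [0, q^j d^j]];
   when [j]_q != 0 it is equivalent to d^(j-1) + d^(j+1).  So for 0 < j < m the
   rank r_j(n,k) of d^j on M^n_k satisfies
     r_j(n,k) = r_(j+1)(n-1,k) + r_(j-1)(n-1,k-1) + (q^(n-1)-1) r_j(n-2,k-1),
   which gives (i) for all k, and (ii), (iii), (iv) follow by induction on n. *)

(** * Chains *)

Lemma lfun_of_linear (R : fieldType) (U V : vectType R) (f : U -> V) :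
  linear f -> exists g : 'Hom(U, V), forall x, g x = f x.
Proof.
move=> f_lin; pose l := GRing.isLinear.Build R U V _ f f_lin.
pose h : {linear U -> V} := HB.pack f l.
by exists (linfun h) => x; rewrite lfunE.
Qed.

Lemma exists_embedding (R : fieldType) (V : vectType R) (U : {vspace V}) :
  exists g : 'Hom('rV[R]_(\dim U), V), lker g = 0%VS /\ limg g = U.
Proof.
pose h (r : 'rV[R]_(\dim U)) : V := \sum_i r 0 i *: (vbasis U)`_i.
have [g gE] : exists g : 'Hom('rV[R]_(\dim U), V), forall x, g x = h x.
  apply: lfun_of_linear => c x y; rewrite /h scaler_sumr -big_split /=.
  by apply: eq_bigr => i _; rewrite !mxE scalerDl scalerA.
have fU := basis_free (vbasisP U).
exists g; split.
  apply/eqP; rewrite -subv0; apply/subvP => x; rewrite memv_ker gE memv0.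
  move/eqP => hx; apply/eqP/rowP => i; rewrite mxE.
  by have := @freeP _ _ _ (vbasis U) fU (fun i => x 0 i) hx i.
apply/vspaceP => u; apply/memv_imgP/idP => [[x _ ->]|uU].
  by rewrite gE memv_suml // => i _; rewrite memvZ // vbasis_mem // mem_nth ?size_tuple.
exists (\row_i coord (vbasis U) i u); rewrite ?memvf // gE [LHS](coord_vbasis uU).
by apply: eq_bigr => i _; rewrite mxE.
Qed.

Definition cofaceb (K : fieldType) (vT : vectType K) (y x : {vspace vT}) :=
  (y <= x)%VS && ((\dim y).+1 == \dim x).

Lemma dim_limg_ker0 (K : fieldType) (aT rT : vectType K) (f : 'Hom(aT, rT))
  (U : {vspace aT}) : lker f == 0%VS -> \dim (f @: U) = \dim U.
Proof. by move/eqP=> f0; apply: limg_dim_eq; rewrite f0 capv0. Qed.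

Lemma preimK_ker0 (K : fieldType) (aT rT : vectType K) (f : 'Hom(aT, rT)) :
  lker f == 0%VS -> cancel (fun U => f @: U)%VS (fun U => f @^-1: U)%VS.
Proof.
move=> f0 U; apply/vspaceP => u; rewrite -memv_preim.
by apply/memv_imgP/idP => [[v vU /(lker0P f0) ->] //|uU]; exists u.
Qed.

Lemma cofaceb_img (K : fieldType) (aT rT : vectType K) (f : 'Hom(aT, rT))
  (y x : {vspace aT}) :
  lker f == 0%VS -> cofaceb (f @: y)%VS (f @: x)%VS = cofaceb y x.
Proof. by move=> f0; rewrite /cofaceb limg_ker0 // !dim_limg_ker0. Qed.

Arguments incidence_pow : simpl never.

Section Chains.
Variables (K : finFieldType) (F : fieldType).
Local Notation sub n := {vspace 'rV[K]_n}.
Local Notation chn n := (chains K F n%:Z).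
Local Notation bd n := (incidence K F n%:Z).
Local Notation bdp n := (incidence_pow K F n%:Z).
Local Notation q := (#|{: K}|).

(** Transposing the definition gives a formula for single values, so that identities between chains
    can be checked pointwise. *)
Lemma incidenceE n (f : chn n) (y : sub n) :
  bd n f y = \sum_(x | cofaceb y x) f x.
Proof.
rewrite lfunE /= /incidence_fun sum_ffunE [RHS]big_mkcond /=.
apply: eq_bigr => x _; rewrite !ffunE sum_ffunE -/(cofaceb y x).
under eq_bigr do rewrite ffunE eq_sym.
rewrite big_mkcond (bigD1 y) //= eqxx big1 ?addr0.
  by rewrite -/(cofaceb y x); case: ifP => _; rewrite ?scaler0 // /GRing.scale /= mulr1.
by move=> z /negPf ->; case: ifP.
Qed.

(** Trades the span for a condition on the support, which suits chains that are defined by their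
    values. *)
Lemma memMod n (k : int) (f : chn n) :
  reflect (forall x : sub n, f x != 0 -> (\dim x)%:Z = k) (f \in Mod K F n%:Z k).
Proof.
apply: (iffP idP) => [|fk].
  move=> fM x; apply: contraNeq => xk.
  have {fM} [c ->] : exists c : sub n -> F, f = \sum_(x in Lset K n%:Z k) c x *: basis_vec F x.
    move: fM; rewrite /Mod; set s := [seq _ | _ in _] => fM.
    pose X := in_tuple s; have {fM} -> := coord_span (X := X) fM.
    have : {in s, forall v, exists c : sub n -> F, v = \sum_(x in Lset K n%:Z k) c x *: basis_vec F x}.
      move=> v /mapP[z]; rewrite mem_enum => zL ->; exists (fun t => (t == z)%:R).
      rewrite (bigD1 z) //= eqxx scale1r big1 ?addr0 // => t /andP[_ /negPf ->].
      by rewrite scale0r.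
    move=> sP; pose P v := exists c : sub n -> F, v = \sum_(x in Lset K n%:Z k) c x *: basis_vec F x.
    apply: (big_ind P) => [|u v [c ->] [d ->]|i _].
    - by exists (fun=> 0); rewrite big1 // => t _; rewrite scale0r.
    - exists (fun t => c t + d t); rewrite -big_split; apply: eq_bigr => t _.
      by rewrite scalerDl.
    - have [c ->] := sP _ (mem_nth 0 (ltn_ord i)).
      by exists (fun t => coord X i f * c t); rewrite scaler_sumr;
        apply: eq_bigr => t _; rewrite scalerA.
  rewrite sum_ffunE big1 // => t; rewrite inE => /andP[_ /eqP tk].
  by rewrite !ffunE; case: eqP => [xt|]; rewrite ?scaler0 //; rewrite xt tk eqxx in xk.
have -> : f = \sum_(x in Lset K n%:Z k) f x *: basis_vec F x.
  apply/ffunP => x; rewrite sum_ffunE.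
  under eq_bigr do rewrite !ffunE.
  have [xL|] := boolP (x \in Lset K n%:Z k).
    rewrite (bigD1 x) //= eqxx /GRing.scale /= mulr1 big1 ?addr0 // => t /andP[_].
    by rewrite eq_sym => /negPf ->; rewrite mulr0.
  move=> xL; rewrite big1.
    by apply/eqP; apply: contraR xL => /fk xk; rewrite inE xk eqxx.
  move=> t tL; case: eqP => [xt|]; last by rewrite scaler0.
  by rewrite xt tL in xL.
apply: memv_suml => x xL; apply: memvZ; apply: memv_span.
by apply/mapP; exists x; rewrite ?mem_enum.
Qed.

Lemma dim_Mod n (k : int) : \dim (Mod K F n%:Z k) = qbinom K n%:Z k.
Proof.
rewrite /Mod /qbinom cardE; set s := [seq _ | _ in _].
have -> : size (enum (Lset K n%:Z k)) = size s by rewrite size_map.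
apply/eqP; rewrite -/(free s).
rewrite -[s]/(tval (in_tuple s)); apply/freeP => c /ffunP cs i.
have := ltn_ord i; rewrite {2}size_map => iL.
pose x0 : subsp K n%:Z := 0%VS.
have sE j : s`_j = if (j < size s)%N then basis_vec F (nth x0 (enum (Lset K n%:Z k)) j) else 0.
  case: ltnP => js; last by rewrite nth_default.
  by rewrite /s (nth_map x0) //; move: js; rewrite size_map.
have := cs (nth x0 (enum (Lset K n%:Z k)) i); rewrite sum_ffunE ffunE (bigD1 i) //=.
rewrite !ffunE sE ltn_ord !ffunE eqxx big1 ?addr0 /GRing.scale /= ?mulr1 //.
move=> j ji; have := ltn_ord j; rewrite {2}size_map => jL.
rewrite !ffunE sE ltn_ord ffunE nth_uniq ?enum_uniq // (inj_eq val_inj).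
by rewrite eq_sym (negPf ji) /GRing.scale /= mulr0.
Qed.

Lemma bdD n (f h : chn n) : bd n (f + h) = bd n f + bd n h.
Proof. exact: linearD. Qed.

Lemma bdZ n a (f : chn n) : bd n (a *: f) = a *: bd n f.
Proof. exact: linearZ. Qed.

Lemma bdpD n j (f h : chn n) : bdp n j (f + h) = bdp n j f + bdp n j h.
Proof. exact: linearD. Qed.

Lemma bdpB n j (f h : chn n) : bdp n j (f - h) = bdp n j f - bdp n j h.
Proof. exact: linearB. Qed.

Lemma bdpZ n j a (f : chn n) : bdp n j (a *: f) = a *: bdp n j f.
Proof. exact: linearZ. Qed.

Lemma bdpS n j (f : chn n) : bdp n j.+1 f = bd n (bdp n j f).
Proof. by rewrite /incidence_pow iterS comp_lfunE. Qed.

Lemma bdp0 n (f : chn n) : bdp n 0 f = f.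
Proof. by rewrite /incidence_pow /= id_lfunE. Qed.

Lemma bdpSr n j (f : chn n) : bdp n j.+1 f = bdp n j (bd n f).
Proof. by elim: j => [|j IH]; [rewrite bdpS !bdp0 | rewrite bdpS IH -bdpS]. Qed.

Lemma bd_Mod n (k : int) (f : chn n) : f \in Mod K F n%:Z k -> bd n f \in Mod K F n%:Z (k - 1).
Proof.
move/memMod => fk; apply/memMod => y; rewrite incidenceE => yn0.
have [x /andP[/andP[_ /eqP yx] fx]] : exists x, cofaceb y x && (f x != 0).
  apply/existsP; apply: contraR yn0; rewrite negb_exists => /forallP H.
  rewrite big1 // => x yx; have := H x; rewrite yx negbK; exact: eqP.
by rewrite -(fk _ fx) -yx intS addrC addKr.
Qed.

End Chains.

Lemma card_subspace (K : finFieldType) (n : nat) (A : {vspace 'rV[K]_n}) :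
  #|A| = (#|{: K}| ^ \dim A)%N.
Proof.
have [g [/eqP/lker0P g_inj gA]] := exists_embedding A.
rewrite -[RHS]mul1n -[X in (_ ^ X)%N]mul1n -card_mx -(card_imset predT g_inj) mul1n.
apply: eq_card => u; rewrite -{1}gA.
by apply/memv_imgP/imsetP => -[x xP ->]; exists x; rewrite ?memvf.
Qed.

(** * Push-forward of chains along an injective linear map *)

Section Push.
Variables (K : finFieldType) (F : fieldType).
Local Notation sub n := {vspace 'rV[K]_n}.
Local Notation chn n := (chains K F n%:Z).
Local Notation bd n := (incidence K F n%:Z).

Variables (d e : nat) (g : 'Hom('rV[K]_d, 'rV[K]_e)).
Hypothesis g_inj : lker g == 0%VS.

Definition push_fun (z : chn d) : chn e :=
  [ffun A : sub e => if (A <= limg g)%VS then z (g @^-1: A)%VS else 0].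

Lemma push_fun_linear : linear push_fun.
Proof.
move=> a x y; apply/ffunP => A; rewrite !ffunE; case: ifP => // _.
by rewrite scaler0 addr0.
Qed.

HB.instance Definition _ :=
  GRing.isLinear.Build F (chn d) (chn e) _ push_fun push_fun_linear.

Definition push : 'Hom(chn d, chn e) := linfun push_fun.

Lemma pushE (z : chn d) (A : sub e) :
  push z A = if (A <= limg g)%VS then z (g @^-1: A)%VS else 0.
Proof. by rewrite lfunE /= ffunE. Qed.

Lemma push_img (z : chn d) (B : sub d) : push z (g @: B)%VS = z B.
Proof. by rewrite pushE limgS ?subvf // preimK_ker0. Qed.

Lemma push_notin (z : chn d) (A : sub e) : ~~ (A <= limg g)%VS -> push z A = 0.
Proof. by rewrite pushE => /negPf ->. Qed.

Lemma push_coface (y : sub d) (f : chn e) :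
  \sum_(x | cofaceb (g @: y : sub e)%VS x && (x <= limg g)%VS) f x
  = \sum_(x | cofaceb y x) f (g @: x)%VS.
Proof.
rewrite (reindex_onto (fun x : sub d => g @: x : sub e)%VS
                      (fun x : sub e => g @^-1: x : sub d)%VS) /=.
  apply: eq_bigl => x; rewrite preimK_ker0 // eqxx andbT limgS ?subvf // andbT.
  by rewrite cofaceb_img.
by move=> x /andP[_]; exact: lpreimK.
Qed.

(** Cofaces of [g @: y] inside the image of g are the images of cofaces of y, and a subspace not
    inside the image has no coface inside it. *)
Lemma incidence_push (z : chn d) : bd e (push z) = push (bd d z).
Proof.
apply/ffunP => y; rewrite incidenceE.
rewrite (bigID (fun x : sub e => (x <= limg g)%VS)) /= [X in _ + X]big1 ?addr0; last first.
  by move=> x /andP[_]; exact: push_notin.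
have [yg|yg] := boolP (y <= limg g)%VS.
  rewrite -(lpreimK yg) push_coface push_img incidenceE.
  by apply: eq_bigr => x _; rewrite push_img.
rewrite push_notin // big1 // => x /andP[/andP[yx _] xg].
by rewrite (subv_trans yx xg) in yg.
Qed.

Lemma push_Mod (k : int) (z : chn d) :
  z \in Mod K F d%:Z k -> push z \in Mod K F e%:Z k.
Proof.
move/memMod => zk; apply/memMod => A; rewrite pushE; case: ifP => [Ag /zk <-|]; last by rewrite eqxx.
by rewrite -{1}(lpreimK Ag) dim_limg_ker0 //.
Qed.

End Push.

(** * Flats over a hyperplane *)

Section Flats.
Variables (K : fieldType) (n : nat).
Local Notation W := 'rV[K]_n.
Local Notation V := 'rV[K]_n.+1.

(** Homogeneous coordinates: c = 0 is the hyperplane W, and c = 1 is an affine copy of W whose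
    points span the lines outside the hyperplane. *)
Definition homog (c : K) (w : W) : V := row_mx (c%:M : 'M_1) w.

Lemma homogD c d w u : homog c w + homog d u = homog (c + d) (w + u).
Proof. by rewrite /homog raddfD [LHS](@add_row_mx K 1 1 n). Qed.

Lemma homogZ a c w : a *: homog c w = homog (a * c) (a *: w).
Proof. by rewrite /homog -scale_scalar_mx [LHS](@scale_row_mx K 1 1 n). Qed.

Lemma homogN c w : - homog c w = homog (- c) (- w).
Proof. by rewrite -!scaleN1r homogZ mulN1r. Qed.

Lemma homog_inj c d w u : homog c w = homog d u -> c = d /\ w = u.
Proof.
move/(@eq_row_mx K 1 1 n) => [] /matrixP/(_ 0 0); rewrite !mxE !mulr1n.
by move=> -> ->.
Qed.

Lemma homog_surj (u : V) : exists c w, u = homog c w.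
Proof.
exists (lsubmx (u : 'M_(1, 1 + n)) 0 0), (rsubmx (u : 'M_(1, 1 + n))).
by rewrite /homog -mx11_scalar hsubmxK.
Qed.

Lemma homog0_linear : linear (homog 0).
Proof. by move=> a x y; rewrite homogZ homogD mulr0 addr0. Qed.

HB.instance Definition _ := GRing.isLinear.Build K W V _ (homog 0) homog0_linear.

Definition hyp_emb : 'Hom(W, V) := linfun (homog 0).

Lemma hyp_embE w : hyp_emb w = homog 0 w.
Proof. by rewrite lfunE. Qed.

Lemma hyp_emb_ker0 : lker hyp_emb == 0%VS.
Proof. by apply/lker0P => x y; rewrite !hyp_embE => /homog_inj[]. Qed.

Definition trace (U : {vspace V}) : {vspace W} := (hyp_emb @^-1: U)%VS.

Definition flat (A : {vspace W}) (w : W) : {vspace V} :=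
  (hyp_emb @: A + <[homog 1 w]>)%VS.

Lemma mem_trace w U : (w \in trace U) = (homog 0 w \in U).
Proof. by rewrite -memv_preim hyp_embE. Qed.

Lemma mem_hyp c w : (homog c w \in limg hyp_emb) = (c == 0).
Proof.
apply/memv_imgP/eqP => [[u _]|->]; first by rewrite hyp_embE => /homog_inj[].
by exists w; rewrite ?memvf ?hyp_embE.
Qed.

Lemma mem_flat_pt A w : homog 1 w \in flat A w.
Proof. by apply: (subvP (addvSr _ _)); apply: memv_line. Qed.

Lemma flat_nhyp A w : (flat A w <= limg hyp_emb)%VS = false.
Proof.
by apply/subvP => /(_ _ (mem_flat_pt A w)); rewrite mem_hyp oner_eq0.
Qed.

Lemma trace_flat A w : trace (flat A w) = A.
Proof.
apply/vspaceP => u; rewrite mem_trace; apply/memv_addP/idP.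
  move=> [x /memv_imgP[a aA ->] [y /vlineP[c ->]]].
  rewrite hyp_embE homogZ homogD add0r mulr1 => /homog_inj[<- ->].
  by rewrite scale0r addr0.
move=> uA; exists (homog 0 u); first by rewrite -hyp_embE memv_img.
by exists 0; rewrite ?mem0v ?addr0.
Qed.

Lemma mem_flat_homog1 A w u : (homog 1 u \in flat A w) = (u - w \in A).
Proof.
rewrite -{2}(trace_flat A w) mem_trace -[u in LHS](subrK w) -[1 in LHS]add0r -homogD.
by rewrite rpredDr // mem_flat_pt.
Qed.

Lemma nhyp_point U : ~~ (U <= limg hyp_emb)%VS -> exists w, homog 1 w \in U.
Proof.
move/subvPn => [u uU]; have [c [w uE]] := homog_surj u.
rewrite uE mem_hyp => c0; exists (c^-1 *: w).
by rewrite -[1](mulVf c0) -homogZ memvZ // -uE.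
Qed.

Lemma flat_trace (U : {vspace V}) w : homog 1 w \in U -> U = flat (trace U) w.
Proof.
move=> wU; apply/eqP; rewrite eqEsubv; apply/andP; split.
  apply/subvP => u; have [c [x ->]] := homog_surj u => uU.
  have -> : homog c x = homog 0 (x - c *: w) + c *: homog 1 w.
    by rewrite homogZ homogD add0r mulr1 subrK.
  rewrite memv_add ?memvZ ?memv_line // -hyp_embE memv_img // mem_trace.
  have -> : homog 0 (x - c *: w) = homog c x - c *: homog 1 w.
    by rewrite homogZ homogN homogD mulr1 subrr.
  by rewrite memvB // memvZ.
rewrite subv_add -memvE wU andbT; apply/subvP => _ /memv_imgP[u uU ->].
by rewrite hyp_embE -mem_trace.
Qed.

Lemma flatP (U : {vspace V}) : ~~ (U <= limg hyp_emb)%VS -> exists A w, U = flat A w.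
Proof. by move/nhyp_point => [w /flat_trace ->]; exists (trace U), w. Qed.

Lemma hypP (U : {vspace V}) : (U <= limg hyp_emb)%VS -> exists A, U = (hyp_emb @: A)%VS.
Proof. by move=> Uh; exists (trace U); rewrite lpreimK. Qed.

Lemma dim_flat A w : \dim (flat A w) = (\dim A).+1.
Proof.
rewrite dimv_disjoint_sum.
  rewrite dim_limg_ker0 ?hyp_emb_ker0 // dim_vline.
  suff -> : homog 1 w != 0 by exact: addn1.
  by rewrite -[0](linear0 (homog 0)); apply/eqP => /homog_inj[/eqP]; rewrite oner_eq0.
apply/eqP; rewrite -subv0; apply/subvP => u /memv_capP[/memv_imgP[x _ ->] /vlineP[c]].
rewrite hyp_embE homogZ mulr1 => /homog_inj[<- ->].
by rewrite scale0r linear0 mem0v.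
Qed.

Lemma flat_eqP (A B : {vspace W}) w u : reflect (A = B /\ u - w \in A) (flat A w == flat B u).
Proof.
apply: (iffP eqP) => [E|[-> uw]].
  have AB : A = B by rewrite -(trace_flat A w) E trace_flat.
  by split=> //; rewrite -mem_flat_homog1 E mem_flat_pt.
have {2}-> : B = trace (flat B w) by rewrite trace_flat.
by apply: flat_trace; rewrite mem_flat_homog1.
Qed.

Lemma trace_img (A : {vspace W}) : trace (hyp_emb @: A) = A.
Proof. exact: preimK_ker0 hyp_emb_ker0 _. Qed.

(** Whatever contains the flat contains its point [homog 1 w], hence is a flat through the same
    point. So cofaces of a flat correspond to cofaces of its trace. *)
Lemma coface_flat (B : {vspace W}) w U :
  cofaceb (flat B w) U -> U = flat (trace U) w /\ cofaceb B (trace U).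
Proof.
move=> /andP[BU dU]; have wU := subvP BU _ (mem_flat_pt B w).
have UE := flat_trace wU; split=> //; apply/andP; split.
  by rewrite -(trace_flat B w); apply: lpreimS.
by move: dU; rewrite UE !dim_flat trace_flat eqSS.
Qed.

Lemma cofaceb_flat (A B : {vspace W}) w : cofaceb (flat B w) (flat A w) = cofaceb B A.
Proof.
apply/idP/idP => [/coface_flat[_]|/andP[BA dA]]; first by rewrite trace_flat.
by rewrite /cofaceb !dim_flat eqSS dA andbT addvS // limgS.
Qed.

Lemma cofaceb_img_flat (A B : {vspace W}) w :
  cofaceb (hyp_emb @: B)%VS (flat A w) = (A == B).
Proof.
rewrite /cofaceb dim_flat dim_limg_ker0 ?hyp_emb_ker0 // eqSS.
apply/andP/eqP => [[BA dAB]|->]; last by rewrite addvSl.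
apply/esym/eqP; rewrite eqEdim (eqP dAB) leqnn andbT.
by rewrite -(trace_flat A w) -{1}(trace_img B); apply: lpreimS.
Qed.

End Flats.

(** * Fourier analysis on a finite vector space *)

Section DotProduct.
Variables (K : comNzRingType) (n : nat).
Implicit Types u v w : 'rV[K]_n.

Definition dot v w : K := \sum_i v 0 i * w 0 i.

Lemma dotC v w : dot v w = dot w v.
Proof. by apply: eq_bigr => i _; rewrite mulrC. Qed.

Lemma dotDr v w u : dot v (w + u) = dot v w + dot v u.
Proof. by rewrite -big_split; apply: eq_bigr => i _; rewrite mxE mulrDr. Qed.

Lemma dotZr v a w : dot v (a *: w) = a * dot v w.
Proof. by rewrite mulr_sumr; apply: eq_bigr => i _; rewrite mxE mulrCA. Qed.

Lemma dotDl v w u : dot (v + w) u = dot v u + dot w u.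
Proof. by rewrite !(dotC _ u) dotDr. Qed.

Lemma dotZl a v w : dot (a *: v) w = a * dot v w.
Proof. by rewrite dotC dotZr dotC. Qed.

Lemma dot0r v : dot v 0 = 0.
Proof. by rewrite /dot big1 // => i _; rewrite mxE mulr0. Qed.

Lemma dot0l v : dot 0 v = 0.
Proof. by rewrite dotC dot0r. Qed.

Lemma dotBr v w u : dot v (w - u) = dot v w - dot v u.
Proof. by rewrite dotDr -scaleN1r dotZr mulN1r. Qed.

Lemma dot_delta v i : dot v (delta_mx 0 i) = v 0 i.
Proof.
rewrite /dot (bigD1 i) //= mxE !eqxx mulr1 big1 ?addr0 // => j ji.
by rewrite mxE (negPf ji) mulr0.
Qed.

Lemma dot_neq0 v : v != 0 -> exists w, dot v w != 0.
Proof.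
move=> v0; suff /existsP[i vi] : [exists i, v 0 i != 0].
  by exists (delta_mx 0 i); rewrite dot_delta.
apply: contraR v0; rewrite negb_exists => /forallP v0; apply/eqP/rowP => i.
by apply/eqP; have := v0 i; rewrite negbK mxE.
Qed.

End DotProduct.

(** The scalar c makes w - c w' orthogonal to e. If w - c w' is nonzero, correcting f by a multiple
    of e kills the product with w' and keeps the one with w - c w'. *)
Lemma dot_separate (K : fieldType) n (w w' : 'rV[K]_n) : w' != 0 ->
  (exists c, w = c *: w') \/ (exists u, dot w' u = 0 /\ dot w u = 1).
Proof.
move=> /dot_neq0[e w'e]; pose c := dot w e / dot w' e.
have [wc|wc] := eqVneq (w - c *: w') 0; first by left; exists c; apply/subr0_eq.
have [f wf] := dot_neq0 wc; right.
pose u := f - (dot w' f / dot w' e) *: e.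
have w'u : dot w' u = 0 by rewrite dotBr dotZr divfK // subrr.
have wu : dot w u != 0.
  have : dot w u = dot (w - c *: w') f.
    rewrite dotBr dotDl -[- (c *: w')]scaleNr dotZl dotZr /c; congr (_ + _).
    by rewrite mulNr; congr (- _); rewrite [LHS]mulrAC [RHS]mulrAC; congr (_ / _); rewrite mulrC.
  by move=> ->.
by exists ((dot w u)^-1 *: u); rewrite !dotZr w'u mulr0 mulVf.
Qed.

(** A one-sided inverse of a square matrix is two-sided; enumerating T turns the kernels into
    matrices. *)
Lemma kernel_inverseC (F : comUnitRingType) (T : finType) (P Q : T -> T -> F) :
  (forall x y, \sum_t P x t * Q t y = (x == y)%:R) ->
  forall x y, \sum_t Q x t * P t y = (x == y)%:R.
Proof.
move=> PQ x y.
pose M (A : T -> T -> F) := \matrix_(i < #|T|, j < #|T|) A (enum_val i) (enum_val j).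
have ME A B i j : (M A *m M B) i j = \sum_t A (enum_val i) t * B t (enum_val j).
  rewrite mxE [RHS](reindex (@enum_val T predT)).
    by apply: eq_bigr => k _; rewrite !mxE.
  by exists enum_rank => k _; rewrite ?enum_valK ?enum_rankK.
have /mulmx1C/matrixP/(_ (enum_rank x) (enum_rank y)) : M P *m M Q = 1%:M.
  by apply/matrixP => i j; rewrite ME PQ mxE (inj_eq enum_val_inj).
by rewrite ME !enum_rankK mxE (inj_eq enum_rank_inj).
Qed.

Lemma sum_delta (R : pzSemiRingType) (T : finType) (c : T) :
  \sum_x (x == c)%:R = 1 :> R.
Proof. by rewrite (bigD1 c) //= eqxx big1 ?addr0 // => x /negPf ->. Qed.

Section FiniteFourier.
Variables (K : finFieldType) (F : fieldType) (n : nat).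
Local Notation q := (#|{: K}|).
Hypothesis q0 : q%:R != 0 :> F.
Local Notation W := 'rV[K]_n.
Local Notation Wn := ((q ^ n)%:R : F).

(** Translating x by y e, where e lies in A and v.e = 1, shifts the argument of h by y. Summing over
    all y in K then gives the full sum of h for each x in A. *)
Lemma sum_dot_shift (A : {vspace W}) (v u : W) (c : K) (h : K -> F) :
  u \in A -> dot v u != 0 ->
  q%:R * \sum_(x in A) h (c + dot v x) = (q ^ \dim A)%:R * \sum_x h x.
Proof.
move=> uA vu; pose e := (dot v u)^-1 *: u.
have eA : e \in A by rewrite memvZ.
have ve : dot v e = 1 by rewrite dotZr mulVf.
have shift y : \sum_(x in A) h (c + dot v x) = \sum_(x in A) h (y + (c + dot v x)).
  rewrite (reindex_inj (addIr (y *: e))) /=; apply: eq_big => x.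
    by rewrite rpredDr ?memvZ.
  by rewrite dotDr dotZr ve mulr1 addrA addrC.
rewrite mulr_natl -(sumr_const {: K}) (eq_bigr _ (fun y _ => shift y)) exchange_big /=.
rewrite (eq_bigr (fun=> \sum_x h x)) => [|x _].
  by rewrite sumr_const card_subspace mulr_natl.
by rewrite [RHS](reindex_inj (addIr (c + dot v x))).
Qed.

(* Its sum is 0, and its dilates [x |-> spike (a * x)], a != 0, span the functions
   of sum 0 on K: this replaces the nontrivial additive characters, which need
   not take values in F. *)
Definition spike (x : K) : F := (x == 1)%:R - q%:R^-1.

Lemma sum_spike : \sum_x spike x = 0.
Proof.
rewrite big_split /= sumrN sumr_const sum_delta.
by rewrite -[_^-1 *+ _]mulr_natl divff // subrr.
Qed.

Lemma sum_spike_dot (A : {vspace W}) (v u w : W) :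
  u \in A -> dot v u != 0 -> \sum_(x in A) spike (dot v (w + x)) = 0.
Proof.
move=> uA vu; apply: (mulfI q0); under eq_bigr do rewrite dotDr.
by rewrite (sum_dot_shift _ _ uA) // sum_spike !mulr0.
Qed.

Lemma sum_spike_dotT (v : W) : v != 0 -> \sum_x spike (dot v x) = 0.
Proof.
move=> /dot_neq0[u vu]; have := @sum_spike_dot fullv v u 0 (memvf u) vu.
by under eq_bigr do rewrite add0r; under eq_bigl do rewrite memvf.
Qed.

(** Plays the part of the character table of W, with the constant function 1 as trivial
    character. *)
Definition kern (v w : W) : F := if v == 0 then 1 else spike (dot v w).

Let s (x : K) : F := (x == 1)%:R - (x == 0)%:R.

Let card_dot (w : W) (c : K) : w != 0 ->
  q%:R * \sum_(v : W) (dot v w == c)%:R = Wn.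
Proof.
move=> /dot_neq0[u wu]; have := @sum_dot_shift fullv w u 0 (fun x => (x == c)%:R) (memvf u) wu.
rewrite dimvf /dim /= mul1n => H.
have -> : Wn = Wn * \sum_x (x == c)%:R by rewrite sum_delta mulr1.
rewrite -H; congr (_ * _); apply: eq_big => [x|x _]; first by rewrite memvf.
by rewrite add0r dotC.
Qed.

(** The sum of s(v.w) over v is 0, so [spike] may be replaced by the indicator of v.w' = 1. If w = c
    w', then v.w = c on its support, and s(c) is 1 for c = 1 and 0 for any other nonzero c.
    Otherwise a translation fixing v.w' exchanges the conditions v.w = 1 and v.w = 0. *)
Let sum_s_spike (w w' : W) : w != 0 ->
  q%:R * \sum_(v : W) s (dot v w) * spike (dot v w') = Wn * (w == w')%:R.
Proof.
move=> w0.
have s0 : \sum_(v : W) s (dot v w) = 0.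
  apply: (mulfI q0); rewrite mulr0 big_split /= sumrN mulrBr !card_dot // subrr //.
have -> : \sum_(v : W) s (dot v w) * spike (dot v w')
         = \sum_(v : W) s (dot v w) * (dot v w' == 1)%:R.
  under eq_bigr do rewrite mulrBr.
  by rewrite big_split /= sumrN -mulr_suml s0 mul0r subr0.
have [->|w'0] := eqVneq w' 0.
  rewrite (negPf w0) mulr0 big1 ?mulr0 // => v _.
  by rewrite dot0r eq_sym oner_eq0 mulr0.
have [[c wE]|[u [w'u wu]]] := dot_separate w w'0.
  have [c1|c1] := eqVneq c 1.
    rewrite wE c1 scale1r eqxx mulr1 -(@card_dot w' 1) //; congr (_ * _).
    apply: eq_bigr => v _; rewrite /s.
    have [->|_] := eqVneq (dot v w') 1; last by rewrite mulr0.
    by rewrite oner_eq0 subr0 mulr1.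
  have c0 : c != 0 by apply: contraNneq w0 => c0; rewrite wE c0 scale0r.
  have -> : (w == w') = false.
    apply: contraNF c1 => /eqP ww'; rewrite -subr_eq0.
    have : (c - 1) *: w' = 0 by rewrite scalerBl scale1r -wE ww' subrr.
    by move/eqP; rewrite scaler_eq0 (negPf w'0) orbF.
  rewrite mulr0 big1 ?mulr0 // => v _; rewrite wE dotZr /s.
  have [->|_] := eqVneq (dot v w') 1; last by rewrite mulr0.
  by rewrite !mulr1 (negPf c1) (negPf c0) subrr.
have -> : (w == w') = false.
  by apply/eqP => ww'; move: wu; rewrite ww' w'u => /eqP; rewrite eq_sym oner_eq0.
rewrite mulr0; apply/eqP; rewrite mulf_eq0 (negPf q0) /=.
under eq_bigr do rewrite mulrBl.
rewrite big_split /= sumrN subr_eq0; apply/eqP.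
rewrite (reindex_inj (addIr u)) /=; apply: eq_bigr => v _.
by rewrite !dotDl (dotC u w) (dotC u w') wu w'u addr0 -[_ + 1 == 1]subr_eq0 addrK.
Qed.

(** At v = 0 [kern] is 1 instead of [spike 0] = -1/q. As s(0) = -1, the value q^-n there makes the
    term agree with the one in [sum_s_spike]. *)
Let R (w v : W) : F := if v == 0 then Wn^-1 else q%:R / Wn * s (dot v w).

(* Inverts [kern]: for w != 0, [q * sum_v s (v.w) * spike (v.w') = q^n * (w == w')],
   and the row w = 0 is obtained from the constant function, [kern 0]. *)
Let kernV (w v : W) : F :=
  if w == 0 then (v == 0)%:R - \sum_(x | x != 0) R x v else R w v.

Let Wn0 : Wn != 0. Proof. by rewrite natrX expf_neq0. Qed.

Let kernVK w w' : \sum_v kernV w v * kern v w' = (w == w')%:R.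
Proof.
rewrite /kernV.
have RK x : x != 0 -> \sum_v R x v * kern v w' = (x == w')%:R.
  move=> x0; apply: (mulfI Wn0); rewrite -sum_s_spike // mulr_sumr mulr_sumr.
  rewrite (bigD1 0) //= [RHS](bigD1 0) //=; congr (_ + _).
    rewrite /R /kern eqxx mulr1 divff // !dot0l /s /spike eqxx eq_sym oner_eq0 !sub0r.
    by rewrite mulrNN mul1r divff.
  apply: eq_bigr => v /negPf v0; rewrite /R /kern v0.
  by rewrite !mulrA [Wn * _]mulrC mulfK.
have [->|w0] := eqVneq w 0; last exact: RK.
(* Row w = 0: the constant 1 minus the indicators of all x != 0 is the indicator of 0. *)
under eq_bigr do rewrite mulrBl mulr_suml.
rewrite big_split /= sumrN exchange_big /= (eq_bigr _ RK).
rewrite (bigD1 0) //= eqxx /kern eqxx mulr1 big1 ?addr0; last first.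
  by move=> v /negPf ->; rewrite mul0r.
have [<-|w'0] := eqVneq 0 w'.
  by rewrite big1 ?subr0 // => x /negPf ->.
rewrite (bigD1 w') /= 1?eq_sym // eqxx big1 ?addr0 ?subrr // => x /andP[_ /negPf ->] //.
Qed.

(** Linear independence uses the product of the two kernels in the order opposite to [kernVK]. *)
Lemma kern_free (c : W -> F) :
  (forall w, \sum_v c v * kern v w = 0) -> forall v, c v = 0.
Proof.
move=> c0 v; have K' := kernel_inverseC kernVK.
transitivity (\sum_u c u * \sum_w kern u w * kernV w v).
  rewrite (bigD1 v) //= K' eqxx mulr1 big1 ?addr0 // => u /negPf uv.
  by rewrite K' uv mulr0.
under eq_bigr do rewrite mulr_sumr.
rewrite exchange_big big1 //= => w _.
by under eq_bigr do rewrite mulrA; rewrite -mulr_suml c0 mul0r.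
Qed.

Lemma kern_full (f : W -> F) : exists c : W -> F, forall w, f w = \sum_v c v * kern v w.
Proof.
exists (fun v => \sum_u f u * kernV u v) => w.
under eq_bigr do rewrite mulr_suml.
rewrite exchange_big /= (bigD1 w) //= [X in _ = _ + X]big1 => [|u /negPf uw].
  by under eq_bigr do rewrite -mulrA; rewrite -mulr_sumr kernVK eqxx mulr1 addr0.
by under eq_bigr do rewrite -mulrA; rewrite -mulr_sumr kernVK uw mulr0.
Qed.

End FiniteFourier.

Section Perp.
Variables (K : fieldType) (n : nat).

Lemma dot_linear (v : 'rV[K]_n) : linear (dot v : 'rV[K]_n -> K^o).
Proof. by move=> a x y; rewrite dotDr dotZr. Qed.

HB.instance Definition _ v :=
  GRing.isLinear.Build K 'rV[K]_n K^o _ (dot v) (@dot_linear v).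

Definition perp (v : 'rV[K]_n) : {vspace 'rV[K]_n} :=
  lker (linfun (dot v : 'rV[K]_n -> K^o)).

Lemma mem_perp v w : (w \in perp v) = (dot v w == 0).
Proof. by rewrite memv_ker lfunE. Qed.

Lemma dim_perp v : v != 0 -> \dim (perp v) = n.-1.
Proof.
move=> /dot_neq0[w vw]; set f := linfun (dot v : 'rV[K]_n -> K^o).
have := limg_ker_dim f fullv; rewrite capfv dimvf /dim /= mul1n.
suff -> : \dim (limg f) = 1%N by move/(congr1 predn); rewrite addn1.
apply/eqP; rewrite eqn_leq; apply/andP; split.
  by apply: (leq_trans (dimvS (subvf _))); rewrite dimvf.
rewrite lt0n dimv_eq0; apply: contraNneq vw => f0.
by have := memv_img f (memvf w); rewrite f0 memv0 lfunE.
Qed.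

End Perp.

(** * Cones and twisted copies inside the chains of K^(n+1) *)

Section Decomposition.
Variables (K : finFieldType) (F : fieldType) (n : nat).
Local Notation q := (#|{: K}|).
Hypothesis q0 : q%:R != 0 :> F.
Local Notation W := 'rV[K]_n.
Local Notation V := 'rV[K]_n.+1.
Local Notation sub n := {vspace 'rV[K]_n}.
Local Notation chn n := (chains K F n%:Z).
Local Notation bd n := (incidence K F n%:Z).
Local Notation emb := (hyp_emb K n).
Local Notation emb0 := (hyp_emb_ker0 K n).

Lemma incidence_hyp (f : chn n.+1) (B : sub n) :
  bd n.+1 f (emb @: B)%VS = \sum_(A | cofaceb B A) f (emb @: A)%VS
     + \sum_(U : sub n.+1 | ~~ (U <= limg emb)%VS && (trace U == B)) f U.
Proof.
rewrite incidenceE (bigID (fun U : sub n.+1 => (U <= limg emb)%VS)) /=.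
rewrite push_coface ?emb0 //; congr (_ + _); apply: eq_bigl => U.
have [//|Uh] := boolP (U <= limg emb)%VS; first by rewrite andbF.
by rewrite andbT; have [A [w ->]] := flatP Uh; rewrite cofaceb_img_flat trace_flat.
Qed.

(** Each flat with trace B is [flat B w] for the q^(dim B) points w of one coset of B. *)
Lemma sum_flats (f : sub n.+1 -> F) (B : sub n) :
  (q ^ \dim B)%:R * \sum_(U : sub n.+1 | ~~ (U <= limg emb)%VS && (trace U == B)) f U
  = \sum_w f (flat B w).
Proof.
rewrite (partition_big (flat B)
  (fun U : sub n.+1 => ~~ (U <= limg emb)%VS && (trace U == B))) /=; last first.
  by move=> w _; rewrite flat_nhyp trace_flat eqxx.
rewrite mulr_sumr; apply: eq_bigr => U /andP[Uh /eqP UB].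
have [u uU] := nhyp_point Uh; rewrite (flat_trace uU) UB.
under eq_bigr => w /eqP -> do [].
rewrite sumr_const mulr_natl -card_subspace; congr (_ *+ _).
rewrite -(card_imset (mem B) (addIr u)); apply: eq_card => w.
apply/imsetP/flat_eqP => [[x xB ->]|[_ wu]].
  by split=> //; rewrite opprD addrCA subrr addr0 memvN.
by exists (w - u); rewrite ?subrK // -memvN opprB.
Qed.

Lemma incidence_flat (f : chn n.+1) (B : sub n) w :
  bd n.+1 f (flat B w) = \sum_(A | cofaceb B A) f (flat A w).
Proof.
rewrite incidenceE (reindex_onto (fun A => flat A w) (fun U => trace U)) /=.
  by apply: eq_bigl => A; rewrite trace_flat eqxx andbT cofaceb_flat.
by move=> U /coface_flat[].
Qed.

Lemma chain_eq (f g : chn n.+1) :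
  (forall A, f (emb @: A)%VS = g (emb @: A)%VS) ->
  (forall A w, f (flat A w) = g (flat A w)) -> f = g.
Proof.
move=> fg_hyp fg_flat; apply/ffunP => U; have [/hypP[A ->]|/flatP[A [w ->]]] :=
  boolP ((U : sub n.+1) <= limg emb)%VS; [exact: fg_hyp|exact: fg_flat].
Qed.

(** A chosen representative of the coset; the default 0 occurs only for subspaces of the
    hyperplane. *)
Definition point (U : sub n.+1) : W := odflt 0 [pick w | homog 1 w \in U].

Lemma point_flat (A : sub n) w : point (flat A w) - w \in A.
Proof.
rewrite /point; case: pickP => [u|/(_ w)]; last by rewrite mem_flat_pt.
by rewrite mem_flat_homog1.
Qed.

Section Spread.
Variable c : sub n -> W -> F.

(** The weight is read at the chosen representative. [spread_flat] removes the choice when, for each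
    A in the support of z, the weight is constant on the coset in question. *)
Definition spread_fun (z : chn n) : chn n.+1 :=
  [ffun U : sub n.+1 => if (U <= limg emb)%VS then 0 else c (trace U) (point U) * z (trace U)].

Lemma spread_fun_linear : linear spread_fun.
Proof.
move=> a x y; apply/ffunP => U; rewrite !ffunE; case: ifP => _.
  by rewrite scaler0 addr0.
by rewrite mulrDr {1}/GRing.scale /= mulrCA.
Qed.

HB.instance Definition _ :=
  GRing.isLinear.Build F (chn n) (chn n.+1) _ spread_fun spread_fun_linear.

Definition spread : 'Hom(chn n, chn n.+1) := linfun spread_fun.

Lemma spread_hyp z (A : sub n) : spread z (emb @: A)%VS = 0.
Proof. by rewrite lfunE /= ffunE limgS ?subvf. Qed.

Lemma spread_flat (z : chn n) (A : sub n) w :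
  (forall u, u - w \in A -> c A u * z A = c A w * z A) ->
  spread z (flat A w) = c A w * z A.
Proof. by move=> cA; rewrite lfunE /= ffunE flat_nhyp trace_flat cA // point_flat. Qed.

Lemma spread_Mod (k : int) z : z \in Mod K F n%:Z k -> spread z \in Mod K F n.+1%:Z (k + 1).
Proof.
move/memMod => zk; apply/memMod => U; rewrite lfunE /= ffunE.
case: ifPn => [|Uh]; first by rewrite eqxx.
rewrite mulf_eq0 negb_or => /andP[_ /zk <-]; have [A [w ->]] := flatP Uh.
by rewrite dim_flat trace_flat intS addrC.
Qed.

End Spread.

Lemma push_emb_flat (z : chn n) (A : sub n) w : push F emb z (flat A w) = 0.
Proof. by rewrite push_notin // flat_nhyp. Qed.

(* The weight q^(dim A - n) compensates for the number of flats over A. *)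
Definition cone : 'Hom(chn n, chn n.+1) :=
  spread (fun A _ => (q ^ \dim A)%:R / (q ^ n)%:R).

Lemma cone_flat z (A : sub n) w : cone z (flat A w) = (q ^ \dim A)%:R / (q ^ n)%:R * z A.
Proof. by rewrite spread_flat. Qed.

(** On the hyperplane, the q^(n - dim B) flats over B of weight q^(dim B - n) add up to z B. On
    flats, a coface has one dimension more, hence q times the weight. *)
Lemma incidence_cone z : bd n.+1 (cone z) = push F emb z + q%:R *: cone (bd n z).
Proof.
apply: chain_eq => [B|B w].
  rewrite incidence_hyp big1 ?add0r; last by move=> A _; rewrite spread_hyp.
  rewrite ffunE push_img ?emb0 // ffunE spread_hyp scaler0 addr0.
  have qd : (q ^ \dim B)%:R != 0 :> F by rewrite natrX expf_neq0.
  apply: (mulfI qd); rewrite sum_flats.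
  under eq_bigr do rewrite cone_flat.
  rewrite sumr_const card_mx mul1n -mulrnAl -mulr_natr divfK //.
  by rewrite natrX expf_neq0.
rewrite incidence_flat ffunE push_emb_flat add0r ffunE cone_flat incidenceE.
rewrite mulr_sumr scaler_sumr; apply: eq_bigr => A /andP[_ /eqP dA].
have {}dA : \dim (A : sub n) = (\dim B).+1 by rewrite -dA.
by rewrite cone_flat dA expnS natrM /GRing.scale /= !mulrA.
Qed.

Section Twist.
Variables (v : W) (g : 'Hom('rV[K]_n.-1, W)).
Hypotheses (v0 : v != 0) (g0 : lker g == 0%VS) (gv : limg g = perp v).

Definition twist : 'Hom(chn n.-1, chn n.+1) :=
  (spread (fun _ w => spike F (dot v w)) \o push F g)%VF.

Lemma twist_hyp z (A : sub n) : twist z (emb @: A)%VS = 0.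
Proof. by rewrite comp_lfunE spread_hyp. Qed.

Lemma twist_flat z (A : sub n) w : twist z (flat A w) = spike F (dot v w) * push F g z A.
Proof.
rewrite comp_lfunE spread_flat // => u uw.
have [Ag|Ag] := boolP (A <= limg g)%VS; last by rewrite push_notin // !mulr0.
have : u - w \in perp v by rewrite -gv (subvP Ag).
by rewrite mem_perp dotBr subr_eq0 => /eqP ->.
Qed.

(** The part in the hyperplane vanishes because the weights sum to 0 over W. On flats the weight
    depends only on the point w, which cofaces share. *)
Lemma incidence_twist z : bd n.+1 (twist z) = twist (bd n.-1 z).
Proof.
apply: chain_eq => [B|B w].
  rewrite twist_hyp incidence_hyp big1 ?add0r; last by move=> A _; rewrite twist_hyp.
  have qd : (q ^ \dim B)%:R != 0 :> F by rewrite natrX expf_neq0.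
  apply: (mulfI qd); rewrite sum_flats mulr0.
  under eq_bigr do rewrite twist_flat.
  by rewrite -mulr_suml sum_spike_dotT // mul0r.
rewrite incidence_flat twist_flat -incidence_push // incidenceE mulr_sumr.
by apply: eq_bigr => A _; rewrite twist_flat.
Qed.

Lemma twist_Mod (k : int) z :
  z \in Mod K F n.-1%:Z k -> twist z \in Mod K F n.+1%:Z (k + 1).
Proof. by move=> zk; rewrite comp_lfunE; apply: spread_Mod; apply: push_Mod. Qed.

End Twist.

End Decomposition.

(** * Decomposition of the chains *)

Section Split.
Variables (K : finFieldType) (F : fieldType) (n : nat).
Local Notation q := (#|{: K}|).
Hypothesis q0 : q%:R != 0 :> F.
Local Notation W := 'rV[K]_n.
Local Notation sub n := {vspace 'rV[K]_n}.
Local Notation chn n := (chains K F n%:Z).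
Local Notation bd n := (incidence K F n%:Z).
Local Notation emb := (hyp_emb K n).
Local Notation emb0 := (hyp_emb_ker0 K n).

Lemma exists_perp_embeddings : exists g : W -> 'Hom('rV[K]_n.-1, W),
  forall v, v != 0 -> lker (g v) == 0%VS /\ limg (g v) = perp v.
Proof.
apply: (@fin_all_exists _ _ (fun v g => v != 0 -> lker g == 0%VS /\ limg g = perp v)) => v.
have [->|v0] := eqVneq v 0; first by exists 0.
have [g [/eqP g0 gv]] := exists_embedding (perp v).
by move: g g0 gv; rewrite (dim_perp v0) => g g0 gv; exists g.
Qed.

Variable g : W -> 'Hom('rV[K]_n.-1, W).
Hypothesis gP : forall v, v != 0 -> lker (g v) == 0%VS /\ limg (g v) = perp v.

Local Notation tw v := (twist F v (g v)).

Definition glue (z1 z2 : chn n) (zv : W -> chn n.-1) : chn n.+1 :=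
  push F emb z1 + cone K F n z2 + \sum_(v | v != 0) tw v (zv v).

(** For fixed A, the Fourier coefficients of the glued chain as a function of the point w of the
    flat. *)
Definition glue_coef (z2 : chn n) (zv : W -> chn n.-1) (A : sub n) (v : W) : F :=
  if v == 0 then (q ^ \dim A)%:R / (q ^ n)%:R * z2 A else push F (g v) (zv v) A.

Lemma glue_hyp z1 z2 zv (A : sub n) : glue z1 z2 zv (emb @: A)%VS = z1 A.
Proof.
rewrite 2!ffunE push_img ?emb0 // spread_hyp addr0 sum_ffunE big1 ?addr0 // => v v0.
by rewrite twist_hyp.
Qed.

Lemma glue_flat z1 z2 zv (A : sub n) w :
  glue z1 z2 zv (flat A w) = \sum_v glue_coef z2 zv A v * kern F v w.
Proof.
rewrite 2!ffunE push_emb_flat add0r cone_flat sum_ffunE [RHS](bigD1 0) //=.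
rewrite /glue_coef /kern eqxx mulr1; congr (_ + _); apply: eq_bigr => v v0.
by have [g0 gv] := gP v0; rewrite twist_flat // (negPf v0) mulrC.
Qed.

Lemma cone_scal_neq0 (A : sub n) : (q ^ \dim A)%:R / (q ^ n)%:R != 0 :> F.
Proof. by rewrite mulf_neq0 ?invr_eq0 // natrX expf_neq0. Qed.

(** Values on the hyperplane recover z1; over each A, independence of the functions [kern v]
    isolates the cone and every twist. *)
Lemma glue_free z1 z2 zv : glue z1 z2 zv = 0 ->
  [/\ z1 = 0, z2 = 0 & forall v, v != 0 -> zv v = 0].
Proof.
move=> z0.
have c0 A v : glue_coef z2 zv A v = 0.
  by apply: (kern_free q0) => w; rewrite -(glue_flat z1) z0 ffunE.
split.
- by apply/ffunP => A; rewrite -(glue_hyp z1 z2 zv) z0 !ffunE.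
- apply/ffunP => A; have := c0 A 0; rewrite /glue_coef eqxx => /eqP.
  by rewrite mulf_eq0 (negPf (cone_scal_neq0 A)) => /eqP ->; rewrite ffunE.
move=> v v0; have [g0 _] := gP v0; apply/ffunP => B.
have := c0 (g v @: B)%VS v; rewrite /glue_coef (negPf v0) push_img // => ->.
by rewrite ffunE.
Qed.

(** Expand f on the flats over each A. Invariance under A forces the coefficient at v to vanish
    unless A lies in [perp v], so the coefficients are those of a cone and of twists. The components
    are chosen before k, so the same ones serve for chains of mixed degree. *)
Lemma glue_surj (f : chn n.+1) : exists z1 z2 zv,
  f = glue z1 z2 zv /\ forall k, f \in Mod K F n.+1%:Z k ->
   [/\ z1 \in Mod K F n%:Z k, z2 \in Mod K F n%:Z (k - 1) &
       forall v, v != 0 -> zv v \in Mod K F n.-1%:Z (k - 1)].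
Proof.
have [c cE] : exists c : sub n -> W -> F,
    forall A w, f (flat A w) = \sum_v c A v * kern F v w.
  apply: (@fin_all_exists _ _
    (fun A d => forall w, f (flat A w) = \sum_v d v * kern F v w)) => A.
  exact: (kern_full q0).
have c_perp A v : v != 0 -> ~~ (A <= perp v)%VS -> c A v = 0.
  move=> v0 Av; pose N : F := #|A|%:R.
  (* [f] is invariant under translation by A; summing over A kills the
     [kern v] with v not orthogonal to A and multiplies the others by [N]. *)
  pose d v := c A v * N - (if (A <= perp v)%VS then c A v * N else 0).
  have d0 : d v = 0.
    apply: (kern_free q0) => w; rewrite {}/d.
    under eq_bigr do rewrite mulrBl.
    rewrite big_split /= sumrN.
    have -> : \sum_x c A x * N * kern F x w = \sum_(u in A) f (flat A (w + u)).
      rewrite [RHS](eq_bigr (fun=> f (flat A w))) => [|u uA].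
        rewrite sumr_const -[RHS]mulr_natl cE mulr_sumr.
        by apply: eq_bigr => x _; rewrite mulrA [N * _]mulrC.
      congr (f _); apply/eqP/flat_eqP; split=> //.
      by rewrite opprD addrA subrr add0r memvN.
    under eq_bigr do rewrite cE.
    rewrite exchange_big /= -sumrB big1 // => x _; rewrite -mulr_sumr /kern.
    have [->|x0] := eqVneq x 0.
      rewrite (_ : (A <= perp 0)%VS) ?mulr1 ?sumr_const ?subrr //.
      by apply/subvP => u _; rewrite mem_perp dot0l.
    case: ifPn => [Ax|/subvPn[u uA]].
      rewrite (eq_bigr (fun=> spike F (dot x w))) => [|u uA].
        by rewrite sumr_const -mulr_natl mulrA subrr.
      by rewrite dotDr; have := subvP Ax u uA; rewrite mem_perp => /eqP ->; rewrite addr0.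
    by rewrite mem_perp => xu; rewrite (sum_spike_dot q0 w uA xu) mul0r mulr0 subr0.
  move: d0; rewrite /d (negPf Av) subr0 => /eqP; rewrite mulf_eq0 => /orP[/eqP //|].
  by rewrite /N card_subspace natrX expf_eq0 (negPf q0) andbF.
pose z1 : chn n := [ffun A : sub n => f (emb @: A)%VS].
pose z2 : chn n := [ffun A : sub n => c A 0 / ((q ^ \dim A)%:R / (q ^ n)%:R)].
pose zv v : chn n.-1 := [ffun B : sub n.-1 => c (g v @: B)%VS v].
exists z1, z2, zv; split.
  apply: chain_eq => [A|A w]; first by rewrite glue_hyp ffunE.
  rewrite glue_flat cE; apply: eq_bigr => v _; congr (_ * _); rewrite /glue_coef.
  have [->|v0] := eqVneq v 0; first by rewrite ffunE mulrC divfK ?cone_scal_neq0.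
  have [g0 gv] := gP v0.
  have [Av|Av] := boolP (A <= limg (g v))%VS.
    by rewrite pushE Av ffunE lpreimK.
  by rewrite push_notin // c_perp // -gv.
move=> k /memMod fk.
(* If f vanished on all flats over A, [kern_free] would make every coefficient over A zero. *)
have ck A v : c A v != 0 -> (\dim A)%:Z = k - 1.
  move=> cAv; suff /existsP[w /fk <-] : [exists w, f (flat A w) != 0].
    by rewrite dim_flat intS [1 + _]addrC addrK.
  apply: contraR cAv; rewrite negb_exists => /forallP fA.
  by apply/eqP; apply: (kern_free q0) => w; rewrite -cE; apply/eqP; have := fA w; rewrite negbK.
split.
- by apply/memMod => A; rewrite ffunE => /fk <-; rewrite dim_limg_ker0 ?emb0.
- by apply/memMod => A; rewrite ffunE mulf_eq0 negb_or => /andP[/ck].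
- move=> v v0; have [g0 _] := gP v0; apply/memMod => B; rewrite ffunE => /ck <-.
  by rewrite dim_limg_ker0.
Qed.

Lemma eq_glue z1 z2 zv y1 y2 yv : z1 = y1 -> z2 = y2 -> zv =1 yv ->
  glue z1 z2 zv = glue y1 y2 yv.
Proof. by move=> -> -> zyv; congr (_ + _); apply: eq_bigr => v _; rewrite zyv. Qed.

Lemma incidence_glue z1 z2 zv : bd n.+1 (glue z1 z2 zv)
  = glue (bd n z1 + z2) (q%:R *: bd n z2) (fun v => bd n.-1 (zv v)).
Proof.
rewrite /glue !linearD linear_sum /= incidence_push ?emb0 // incidence_cone // linearZ /= addrA.
congr (_ + _); apply: eq_bigr => v v0; have [g0 gv] := gP v0.
by rewrite incidence_twist.
Qed.

Lemma glue_Mod k z1 z2 zv : z1 \in Mod K F n%:Z k -> z2 \in Mod K F n%:Z (k - 1) ->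
  (forall v, v != 0 -> zv v \in Mod K F n.-1%:Z (k - 1)) ->
  glue z1 z2 zv \in Mod K F n.+1%:Z k.
Proof.
move=> z1k z2k zvk; rewrite /glue !rpredD ?push_Mod ?emb0 //.
  by rewrite -(subrK 1 k) spread_Mod.
apply: memv_suml => v v0; have [g0 gv] := gP v0.
by rewrite -(subrK 1 k) twist_Mod // zvk.
Qed.

End Split.

(** * Ranks of the powers of the incidence map *)

Definition incidence_rank (K : finFieldType) (F : fieldType) (n j : nat) (k : int) : nat :=
  \dim (incidence_pow K F n%:Z j @: Mod K F n%:Z k).

Lemma qintS (F : fieldType) (q j : nat) : qint F q j.+1 = qint F q j + q%:R ^+ j.
Proof. by rewrite /qint big_ord_recr. Qed.

Section Ranks.
Variables (K : finFieldType) (F : fieldType).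
Local Notation q := (#|{: K}|).
Hypothesis q0 : q%:R != 0 :> F.
Local Notation sub n := {vspace 'rV[K]_n}.
Local Notation chn n := (chains K F n%:Z).
Local Notation bd n := (incidence K F n%:Z).
Local Notation bdp n := (incidence_pow K F n%:Z).
Local Notation M n k := (Mod K F n%:Z k).

Section Recursion.
Variables (n : nat) (g : 'rV[K]_n -> 'Hom('rV[K]_n.-1, 'rV[K]_n)).
Hypothesis gP : forall v, v != 0 -> lker (g v) == 0%VS /\ limg (g v) = perp v.

(** The cone can drop to W at any of the j + 1 steps, picking up a factor q at each step before; the
    contributions add up to 1 + q + ... + q^j. *)
Lemma bdp_glue j z1 z2 zv :
  bdp n.+1 j.+1 (glue g z1 z2 zv)
  = glue g (bdp n j.+1 z1 + qint F q j.+1 *: bdp n j z2)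
         (q%:R ^+ j.+1 *: bdp n j.+1 z2) (fun v => bdp n.-1 j.+1 (zv v)).
Proof.
elim: j => [|j IH].
  rewrite (bdpS _ z1) bdpS !bdp0 incidence_glue //.
  apply: eq_glue => [||v]; last by rewrite bdpS bdp0.
    by rewrite /qint big_ord1 expr0 scale1r.
  by rewrite expr1 bdpS bdp0.
rewrite bdpS IH incidence_glue //; apply: eq_glue => [||v].
- by rewrite bdD bdZ -!bdpS [qint F q j.+2]qintS scalerDl addrA.
- by rewrite bdZ -bdpS scalerA -exprS.
- by rewrite -bdpS.
Qed.

(* Stated with a shear [h], since the image of a power of the incidence map is
   not the glueing of its components, but becomes so after a change of basis. *)
Lemma dim_glue (h : 'End(chn n)) (A B : {vspace chn n}) (C : {vspace chn n.-1})
    (S : {vspace chn n.+1}) :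
  (forall f, f \in S <-> exists u1 u2 uv,
     [/\ u1 \in A, u2 \in B, forall v, v != 0 -> uv v \in C &
         f = glue g u1 (h u1 + u2) uv]) ->
  \dim S = (\dim A + \dim B + (q ^ n - 1) * \dim C)%N.
Proof.
move=> SE; pose th := (push F (hyp_emb K n) + (cone K F n \o h))%VF.
pose tw v := twist F v (g v).
(* One summand per index: [None] for the sheared copy of A, [Some 0] for the cones, [Some v] with v
   != 0 for the twists. *)
pose U (o : option 'rV[K]_n) : {vspace chn n.+1} :=
  if o is Some v then if v == 0 then (cone K F n @: B)%VS else (tw v @: C)%VS
  else (th @: A)%VS.
have glueE u1 u2 uv : glue g u1 (h u1 + u2) uv
    = th u1 + (cone K F n u2 + \sum_(v | v != 0) tw v (uv v)).
  by rewrite /glue linearD add_lfunE comp_lfunE !addrA.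
have sumU w : (forall o, w o \in U o) -> exists u1 u2 uv,
    [/\ [/\ u1 \in A, u2 \in B & forall v, v != 0 -> uv v \in C],
        [/\ w None = th u1, w (Some 0) = cone K F n u2
          & forall v, v != 0 -> w (Some v) = tw v (uv v)]
      & \sum_o w o = glue g u1 (h u1 + u2) uv].
  move=> wU; have /memv_imgP[u1 u1A w1] := wU None.
  have /memv_imgP[u2 u2B w2] : w (Some 0) \in (cone K F n @: B)%VS.
    by have := wU (Some 0); rewrite /U eqxx.
  have [uv uvP] : exists uv, forall v, v != 0 -> uv v \in C /\ w (Some v) = tw v (uv v).
    apply: (@fin_all_exists _ _
      (fun v (x : chn n.-1) => v != 0 -> x \in C /\ w (Some v) = tw v x)) => v.
    have [->|v0] := eqVneq v 0; first by exists 0.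
    have := wU (Some v); rewrite /U (negPf v0) => /memv_imgP[x xC ->].
    by exists x.
  exists u1, u2, uv; split; first by split=> // v /uvP[].
    by split=> // v /uvP[].
  rewrite glueE (bigD1 None) //= w1; congr (_ + _).
  rewrite (bigD1 (Some 0)) //= w2; congr (_ + _).
  rewrite (reindex_omap Some id) => [|[v|]] //=.
  apply: eq_big => v; first by rewrite eqxx andbT (inj_eq Some_inj).
  by rewrite (inj_eq Some_inj) => /andP[/uvP[]].
have -> : S = (\sum_o U o)%VS.
  apply/vspaceP => f; apply/idP/idP => [/SE[u1 [u2 [uv [u1A u2B uvC ->]]]]|].
    rewrite glueE rpredD //.
      by apply: (subvP (sumv_sup None _ (subvv (U None)))) => //; apply: memv_img.
    rewrite rpredD //.
      apply: (subvP (sumv_sup (Some 0) _ (subvv (U (Some 0))))) => //.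
      by rewrite /U eqxx memv_img.
    apply: memv_suml => v v0.
    apply: (subvP (sumv_sup (Some v) _ (subvv (U (Some v))))) => //.
    by rewrite /U (negPf v0) memv_img // uvC.
  move=> /memv_sumP[w wU ->]; apply/SE.
  have [u1 [u2 [uv [[? ? ?] _ ->]]]] := sumU w (fun o => wU o isT).
  by exists u1, u2, uv.
have /directvP /= -> : directv (\sum_o U o)%VS.
  apply/directv_sum_independent => w wU w0.
  have [u1 [u2 [uv [_ [w1 w2 wv] wE]]]] := sumU w (fun o => wU o isT).
  have [u10 hu20 uv0] := glue_free q0 gP (etrans (esym wE) w0).
  have u20 : u2 = 0 by rewrite -hu20 u10 linear0 add0r.
  move=> [v|] _; last by rewrite w1 u10 linear0.
  have [->|v0] := eqVneq v 0; first by rewrite w2 u20 linear0.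
  by rewrite wv // uv0 // linear0.
(* Each summand is an injective image: apply [glue_free] with the other components zero. *)
have glue1 u : glue g 0 u (fun=> 0) = cone K F n u.
  by rewrite /glue linear0 add0r big1 ?addr0 // => v _; rewrite linear0.
have cone0 : lker (cone K F n) == 0%VS.
  rewrite -subv0; apply/subvP => u; rewrite memv_ker -glue1 => /eqP.
  by move=> /(glue_free q0 gP)[_ -> _]; rewrite mem0v.
have th0 : lker th == 0%VS.
  rewrite -subv0; apply/subvP => u; rewrite memv_ker => /eqP tu.
  have : glue g u (h u + 0) (fun=> 0) = 0.
    by rewrite glueE tu linear0 !add0r big1 // => v _; rewrite linear0.
  by move=> /(glue_free q0 gP)[-> _ _]; rewrite mem0v.
have tw0 v : v != 0 -> lker (tw v) == 0%VS.
  move=> v0; rewrite -subv0; apply/subvP => u; rewrite memv_ker => /eqP tu.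
  pose uv x : chn n.-1 := if x == v then u else 0.
  have : glue g 0 0 uv = 0.
    rewrite /glue !linear0 !add0r big1 // => x _; rewrite /uv.
    by case: eqP => [->|_]; rewrite ?linear0.
  by move=> /(glue_free q0 gP)[_ _ /(_ v v0)]; rewrite /uv eqxx => ->; rewrite mem0v.
rewrite (bigD1 None) //= dim_limg_ker0 // -addnA; congr (_ + _)%N.
rewrite (bigD1 (Some 0)) //= eqxx dim_limg_ker0 //; congr (_ + _)%N.
rewrite (reindex_omap Some id) => [|[v|]] //=.
rewrite (eq_big (fun v => v != 0) (fun=> \dim C)) => [|v|v].
- by rewrite sum_nat_const cardC1 card_mx mul1n subn1.
- by rewrite eqxx andbT (inj_eq Some_inj).
- by rewrite eqxx andbT (inj_eq Some_inj) => v0; rewrite (negPf v0) dim_limg_ker0 ?tw0.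
Qed.

End Recursion.
End Ranks.

Section RankRecursion.
Variables (K : finFieldType) (F : fieldType).
Local Notation q := (#|{: K}|).
Hypothesis q0 : q%:R != 0 :> F.
Local Notation sub n := {vspace 'rV[K]_n}.
Local Notation chn n := (chains K F n%:Z).
Local Notation bd n := (incidence K F n%:Z).
Local Notation bdp n := (incidence_pow K F n%:Z).
Local Notation M n k := (Mod K F n%:Z k).

Lemma incidence_rank0 n k : incidence_rank K F n 0 k = qbinom K n%:Z k.
Proof.
rewrite /incidence_rank -(dim_Mod K F); congr (\dim _); apply/vspaceP => f.
by apply/memv_imgP/idP => [[z zk ->]|fk]; [rewrite bdp0|exists f; rewrite ?bdp0].
Qed.

(** Dimension count for the graded decomposition itself, without shear. For n = 0 the last
    coefficient is 0, which makes the truncated [n.-1] harmless. *)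
Lemma qbinomS n k : qbinom K n.+1%:Z k
  = (qbinom K n%:Z k + qbinom K n%:Z (k - 1)
     + (q ^ n - 1) * qbinom K n.-1%:Z (k - 1))%N.
Proof.
have [g gP] := exists_perp_embeddings K n.
rewrite -!(dim_Mod K F) (dim_glue q0 gP (h := 0) (A := M n k) (B := M n (k - 1)) (C := M n.-1 (k - 1))) //.
move=> f; split=> [fk|[z1 [z2 [zv [z1k z2k zvk ->]]]]].
  have [z1 [z2 [zv [fE /(_ k fk)[z1k z2k zvk]]]]] := glue_surj q0 gP f.
  by exists z1, z2, zv; rewrite lfunE add0r.
by rewrite lfunE add0r glue_Mod.
Qed.

(** With [j] invertible and c = q^j / [j], put u1 = d^(j-1)(d z1 + [j] z2). The cone component q^j
    d^j z2 of the image equals c d u1 - c d^(j+1) z1, and u1 and d^(j+1) z1 vary independently. The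
    shear is therefore c d. *)
Lemma incidence_rankS n j k : (0 < j)%N -> qint F q j != 0 ->
  incidence_rank K F n.+1 j k = (incidence_rank K F n j.+1 k + incidence_rank K F n j.-1 (k - 1)
                     + (q ^ n - 1) * incidence_rank K F n.-1 j (k - 1))%N.
Proof.
case: j => // j _ j0; have [g gP] := exists_perp_embeddings K n.
pose c : F := q%:R ^+ j.+1 / qint F q j.+1.
(* The W component of the image carries the lower power, so it comes first in [dim_glue]. *)
rewrite [X in (X + _)%N]addnC /incidence_rank /=.
apply: (dim_glue q0 gP (h := c *: bd n)%VF) => f; split.
  move=> /memv_imgP[y yk ->].
  have [z1 [z2 [zv [yE /(_ k yk)[z1k z2k zvk]]]]] := glue_surj q0 gP y.
  rewrite yE bdp_glue //.
  exists (bdp n j (bd n z1 + qint F q j.+1 *: z2)), (- c *: bdp n j.+2 z1).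
  exists (fun v => bdp n.-1 j.+1 (zv v)); split.
  - by rewrite memv_img // rpredD ?memvZ // bd_Mod.
  - by rewrite memvZ // memv_img.
  - by move=> v v0; rewrite memv_img // zvk.
  apply: eq_glue => //; first by rewrite bdpD -bdpSr bdpZ.
rewrite scale_lfunE -bdpS bdpD bdpZ -bdpSr. rewrite scalerDr scalerA scaleNr addrAC subrr add0r.
  by rewrite /c divfK.
move=> [_ [_ [uv [/memv_imgP[y yk ->] /memv_imgP[z zk ->] uvC ->]]]].
have [xv xvP] : exists xv, forall v, v != 0 -> xv v \in M n.-1 (k - 1) /\ uv v = bdp n.-1 j.+1 (xv v).
  apply: (@fin_all_exists _ _
    (fun v (x : chn n.-1) => v != 0 -> x \in M n.-1 (k - 1) /\ uv v = bdp n.-1 j.+1 x)) => v.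
  have [->|v0] := eqVneq v 0; first by exists 0.
  by have /memv_imgP[x xk ->] := uvC v v0; exists x.
have c0 : c != 0 by rewrite mulf_neq0 ?invr_eq0 ?expf_neq0.
(* Inverse of the change of variables [y = [j] z2 + d z1], [z = - c z1]. *)
pose z1 := - c^-1 *: z; pose z2 := (qint F q j.+1)^-1 *: (y - bd n z1).
apply/memv_imgP; exists (glue g z1 z2 xv).
  rewrite glue_Mod //; first by rewrite memvZ.
    by rewrite memvZ // rpredB // bd_Mod // memvZ.
  by move=> v /xvP[].
rewrite bdp_glue //; apply: esym.
have z2E i : qint F q j.+1 *: bdp n i z2 = bdp n i y - bdp n i.+1 z1.
  by rewrite bdpZ scalerA divff // scale1r bdpB -bdpSr.
rewrite z2E addrC subrK /glue; congr (_ + _ + _); last first.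
  by apply: eq_bigr => v /xvP[_ ->].
congr (cone _ _ _ _); have -> : q%:R ^+ j.+1 = c * qint F q j.+1 by rewrite divfK.
rewrite -scalerA z2E scale_lfunE -bdpS scalerBr; congr (_ + _).
by rewrite bdpZ scalerA mulrN divff // scaleNr opprK scale1r.
Qed.

Lemma cofaceb0 (x y : sub 0) : cofaceb y x = false.
Proof.
rewrite /cofaceb; have := dimvS (subvf x); rewrite dimvf /dim /= muln0 leqn0 => /eqP ->.
by rewrite andbF.
Qed.

Lemma incidence_rank_n0 j k : (0 < j)%N -> incidence_rank K F 0 j k = 0%N.
Proof.
case: j => // j _; apply/eqP; rewrite dimv_eq0 -lkerE; apply/subvP => f _.
rewrite memv_ker bdpS; apply/eqP/ffunP => y; rewrite incidenceE big_pred0 ?ffunE // => x.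
exact: cofaceb0.
Qed.

(** In [bdp_glue] every term is an m-th power in smaller dimension, except the one with coefficient
    [m] = 0. *)
Lemma bdp_nilp m : qint F q m = 0 -> (0 < m)%N -> forall n (f : chn n), bdp n m f = 0.
Proof.
case: m => // m m0 _; elim/ltn_ind => -[|n] IH f.
  rewrite bdpS; apply/ffunP => y; rewrite incidenceE big_pred0 ?ffunE // => x.
  exact: cofaceb0.
have [g gP] := exists_perp_embeddings K n.
have [z1 [z2 [zv [-> _]]]] := glue_surj q0 gP f.
rewrite bdp_glue // !IH ?ltnS ?leq_pred // m0 scale0r scaler0 addr0.
rewrite /glue !linear0 !add0r big1 // => v v0.
by rewrite IH ?linear0 // ltnS leq_pred.
Qed.

Lemma incidence_rank_nilp m n k : qint F q m = 0 -> (0 < m)%N -> incidence_rank K F n m k = 0%N.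
Proof.
move=> m0 m1; apply/eqP; rewrite dimv_eq0 -lkerE; apply/subvP => f _.
by rewrite memv_ker bdp_nilp.
Qed.

Lemma qbinom0 k : qbinom K 0%:Z k = (k == 0).
Proof.
rewrite /qbinom; have [->|k0] := eqVneq k 0; last first.
  apply: eq_card0 => x; rewrite !inE; apply: contraNF k0 => /eqP <-.
  by have := dimvS (subvf x); rewrite dimvf /dim /= muln0 leqn0.
rewrite -[RHS](card1 (0%VS : subsp K 0%:Z)); apply: eq_card => x; rewrite !inE.
have := dimvS (subvf x); rewrite dimvf /dim /= muln0 leqn0 dimv_eq0 => /eqP x0.
by rewrite x0 eqxx dimv0.
Qed.

Lemma qbinom_oob n k : (k < 0) || (n%:Z < k) -> qbinom K n%:Z k = 0%N.
Proof.
move=> kn; apply: eq_card0 => x; rewrite !inE; apply: contraTF kn => /eqP <-.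
have := dimvS (subvf x); rewrite dimvf /dim /= mul1n => xn.
by rewrite -leNgt lez_nat xn.
Qed.

End RankRecursion.

(** * Betti numbers *)

Section Betti.
Variables (K : finFieldType) (F : fieldType) (m : nat).
Local Notation q := (#|{: K}|).
Hypothesis q0 : q%:R != 0 :> F.
Hypothesis mP : is_min_qint_root F q m.
Local Notation chn n := (chains K F n%:Z).
Local Notation bdp n := (incidence_pow K F n%:Z).
Local Notation M n k := (Mod K F n%:Z k).
Local Notation beta n k i := (betti K F n%:Z m k i).

Lemma min_root_gt1 : (1 < m)%N. Proof. by case: mP. Qed.
Lemma qint_min_root : qint F q m = 0. Proof. by case: mP. Qed.

Lemma qint_neq0 j : (0 < j < m)%N -> qint F q j != 0.
Proof.
case: j => [//|[|j]] jm; first by rewrite /qint big_ord1 expr0 oner_eq0.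
by apply/eqP; case: mP => _ _; apply.
Qed.

Lemma bdp_Mod n j k (f : chn n) : f \in M n k -> bdp n j f \in M n (k - j%:Z).
Proof.
move=> fk; elim: j => [|j IH]; first by rewrite bdp0 subr0.
by rewrite bdpS intS opprD addrCA addrC bd_Mod.
Qed.

Lemma bdp_addn n i j (f : chn n) : bdp n (i + j) f = bdp n i (bdp n j f).
Proof. by elim: i => [|i IH]; rewrite ?bdp0 // addSn !bdpS IH. Qed.

Lemma betti0 n k i : ~~ (0 < i < m)%N -> betti K F n m k i = 0%N.
Proof. by rewrite /betti /homology => /negPf ->; rewrite dimv0. Qed.

(** Rank-nullity for d^i on M_k, with boundaries inside cycles because d^m = 0. The cases i = 0 and
    i = m are included since the recursion moves i by one. *)
Lemma betti_incidence_rank n k i : (i <= m)%N ->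
  (beta n k i + incidence_rank K F n i k + incidence_rank K F n (m - i) (k + m%:Z - i%:Z))%N = qbinom K n%:Z k.
Proof.
move=> im; have m1 := ltnW min_root_gt1.
have [i0|i_gt0] := posnP i.
  by rewrite betti0 i0 // subn0 (incidence_rank_nilp q0 _ _ qint_min_root m1) incidence_rank0 addn0.
have [i_m|i_m] := eqVneq i m.
  by rewrite betti0 i_m ?ltnn ?andbF // subnn incidence_rank0 (incidence_rank_nilp q0 _ _ qint_min_root m1) addrK.
have {}im : (0 < i < m)%N by rewrite i_gt0 ltn_neqAle i_m.
have := dimv_cap_compl (cycles K F n%:Z k i) (boundaries K F n%:Z m k i).
have /capv_idPr -> : (boundaries K F n%:Z m k i <= cycles K F n%:Z k i)%VS.
  apply/subvP => f /memv_imgP[x xk ->]; rewrite memv_cap memv_ker -bdp_addn subnKC; last by lia.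
  rewrite (bdp_nilp q0 qint_min_root) // eqxx /=.
  have := bdp_Mod (m - i) xk.
  by rewrite (_ : k + m%:Z - i%:Z - (m - i)%N%:Z = k); last by lia.
move=> bE; have := limg_ker_dim (bdp n i) (M n k).
rewrite dim_Mod => <-; rewrite capvC -/(cycles K F n%:Z k i) -bE.
by rewrite /betti /homology im /incidence_rank addnC addnA.
Qed.

Lemma bettiS n k i : (0 < i < m)%N ->
  beta n.+1 k i = (beta n k i.+1 + beta n (k - 1) i.-1
                   + beta n.-1 (k - 1) i * (q ^ n - 1))%N.
Proof.
move=> im; have im' : (0 < m - i < m)%N by lia.
have E1 := betti_incidence_rank n.+1 k (i := i) ltac:(lia).
have E2 := betti_incidence_rank n k (i := i.+1) ltac:(lia).
have E3 := betti_incidence_rank n (k - 1) (i := i.-1) ltac:(lia).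
have E4 := betti_incidence_rank n.-1 (k - 1) (i := i) ltac:(lia).
have S0 := qbinomS q0 n k.
have S1 := incidence_rankS q0 n k (j := i) ltac:(lia) (qint_neq0 im).
have S2 := incidence_rankS q0 n (k + m%:Z - i%:Z) (j := m - i) ltac:(lia) (qint_neq0 im').
move: E1 E2 E3 E4 S0 S1 S2.
rewrite (_ : k + m%:Z - i.+1%:Z = k + m%:Z - i%:Z - 1); last by lia.
rewrite (_ : k - 1 + m%:Z - i.-1%:Z = k + m%:Z - i%:Z); last by lia.
rewrite (_ : k - 1 + m%:Z - i%:Z = k + m%:Z - i%:Z - 1); last by lia.
rewrite (_ : m - i.+1 = (m - i).-1)%N; last by lia.
rewrite (_ : m - i.-1 = (m - i).+1)%N; last by lia.
(* The products by q^n - 1 are formed beforehand, leaving a linear problem. *)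
move=> E1 E2 E3 /(congr1 (muln (q ^ n - 1))) E4 S0 S1 S2.
move: E4; rewrite !mulnDr [(_ * beta n.-1 _ _)%N]mulnC; lia.
Qed.

Lemma betti_n0 k i : (0 < i < m)%N -> beta 0 k i = (k == 0).
Proof.
move=> im; have := betti_incidence_rank 0 k (i := i) ltac:(lia).
by rewrite !incidence_rank_n0 ?addn0 ?qbinom0 //; lia.
Qed.

(** The duality exchanges the first two terms of [bettiS] and preserves the third. *)
Lemma betti_duality n k i : (i <= m)%N -> beta n k i = beta n (n%:Z - k) (m - i).
Proof.
elim/ltn_ind: n k i => -[|n] IH k i im.
  have [i0m|i0m] := boolP (0 < i < m)%N.
    by rewrite !betti_n0 //; [rewrite sub0r oppr_eq0 | lia].
  by rewrite !betti0 //; lia.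
have [i0m|i0m] := boolP (0 < i < m)%N; last by rewrite !betti0 //; lia.
rewrite bettiS // [RHS]bettiS; last by lia.
rewrite (IH n _ k i.+1) ?(IH n _ (k - 1) i.-1) //; try lia.
rewrite (_ : n%:Z - (k - 1) = n.+1%:Z - k); last by lia.
rewrite (_ : n%:Z - k = n.+1%:Z - k - 1); last by lia.
rewrite (_ : m - i.+1 = (m - i).-1)%N; last by lia.
rewrite (_ : m - i.-1 = (m - i).+1)%N; last by lia.
rewrite [(beta n _ _.-1 + _)%N]addnC; congr (_ + _)%N.
(* In dimension 1 the third term has coefficient q^0 - 1 = 0. *)
case: n IH => [|n] IH; first by rewrite !muln0.
rewrite [LHS]/= [LHS](congr1 (muln^~ _) (IH n (leqnSn _) (k - 1) i im)).
by rewrite (_ : n%:Z - (k - 1) = n.+2%:Z - k - 1); last by lia.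
Qed.

End Betti.

(** * Alternating sums and the Euler characteristic *)

Lemma fsbig_int (g : int -> int) (N : nat) :
  (forall t : int, ~~ (- N%:Z <= t < N%:Z) -> g t = 0) ->
  \sum_(t \in [set: int]) g t = \sum_(j < N + N) g (j%:Z - N%:Z).
Proof.
move=> g0; rewrite (fsbigE [seq j%:Z - N%:Z | j <- iota 0 (N + N)]) //.
- rewrite (eq_bigl predT) => [|t]; last by rewrite in_setT.
  by rewrite big_map -{1}[(N + N)%N]subn0 -/(index_iota 0 (N + N)) big_mkord.
- by rewrite map_inj_uniq ?iota_uniq // => i j /addIr[].
move=> t _; move: (t : int) => {}t tN; apply: g0; apply: contra tN => tN; apply/mapP.
exists (absz (t + N%:Z)); last by lia.
by rewrite mem_iota; lia.
Qed.

Section Euler.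
Variables (K : finFieldType) (m : nat).
Local Notation q := (#|{: K}|).
Hypothesis m1 : (1 < m)%N.

(* The sum over all t : int of [qbinom n (k + t m)], when N is large. *)
Definition qbinom_sum (N n : nat) (k : int) : int :=
  \sum_(j < N + N) (qbinom K n%:Z (k + (j%:Z - N%:Z) * m%:Z))%:Z.

(** Moving by one period changes only one term at each end of the window, and both are zero for such
    N. *)
Lemma qbinom_sumB N n k : (n + `|k| + 2 <= N)%N ->
  qbinom_sum N n (k - m%:Z) = qbinom_sum N n k.
Proof.
case: N => [|N] nN; [by lia|]; rewrite /qbinom_sum addSn big_ord_recl big_ord_recr /=.
have Nm : N%:Z <= N%:Z * m%:Z by nia.
rewrite !qbinom_oob ?addr0 ?add0r; [|lia|lia].
by apply: eq_bigr => j _; congr (qbinom _ _ _)%:Z; rewrite /= /bump /=; lia.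
Qed.

Lemma qbinom_sum0 N k : (0 < N)%N -> - m%:Z < k < m%:Z ->
  qbinom_sum N 0 k = (k == 0).
Proof.
move=> N0 km; rewrite /qbinom_sum.
have NN : (N < N + N)%N by lia.
rewrite (bigD1 (Ordinal NN)) //= subrr mul0r addr0 qbinom0 big1 ?addr0 //.
move=> j jN; rewrite qbinom0; case: eqP => // jk.
have {}jN : j%:Z - N%:Z != 0 by rewrite subr_eq0; move: jN; rewrite -val_eqE.
by move: jN km jk; move: (j%:Z - N%:Z) => t; nia.
Qed.

Variables (F : fieldType).
Hypothesis q0 : q%:R != 0 :> F.

Lemma qbinom_sumS N n k : qbinom_sum N n.+1 k
  = qbinom_sum N n k + qbinom_sum N n (k - 1) + (q ^ n - 1)%N%:Z * qbinom_sum N n.-1 (k - 1).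
Proof.
rewrite /qbinom_sum mulr_sumr -!big_split /=; apply: eq_bigr => j _.
by rewrite (qbinomS q0) !PoszD PoszM (addrAC k _ (-1)).
Qed.

Hypothesis mP : is_min_qint_root F q m.

(** Both sides obey the same recursion, in which 2k + m - i decreases exactly as n does, so the
    middle condition persists. At i = 0 and i = m both sides vanish, the latter by periodicity. *)
Lemma betti_qbinom_sum N n k i : (i <= m)%N -> (n + `|k| + m + 2 <= N)%N ->
  n%:Z < k + k + m%:Z - i%:Z < n%:Z + m%:Z ->
  (betti K F n%:Z m k i)%:Z = qbinom_sum N n k - qbinom_sum N n (k - i%:Z).
Proof.
elim/ltn_ind: n k i => n IH k i im nN kn.
have [i0m|i0m] := boolP (0 < i < m)%N; last first.
  rewrite betti0 //; have [->|->] : i = 0%N \/ i = m by lia.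
    by rewrite subr0 subrr.
  by rewrite qbinom_sumB ?subrr //; lia.
case: n IH nN kn => [|n] IH nN kn.
  (* Here the middle condition rules out k = i, so the second sum is 0. *)
  by rewrite (betti_n0 q0 mP) // !qbinom_sum0; lia.
rewrite (bettiS q0 mP) // !PoszD PoszM (IH n) ?(IH n _ (k - 1)) //; try lia.
rewrite !qbinom_sumS.
rewrite (_ : k - i.+1%:Z = k - i%:Z - 1); last by lia.
rewrite (_ : k - 1 - i.-1%:Z = k - i%:Z); last by lia.
case: n IH nN kn => [|n] IH nN kn; first by rewrite expn0 subnn !mul0r mulr0; lia.
rewrite (IH n) //; try lia.
rewrite (_ : k - 1 - i%:Z = k - i%:Z - 1); last by lia.
by rewrite mulrC mulrBr /=; lia.
Qed.

Lemma betti_euler n k i : middle_index m n%:Z k i ->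
  (betti K F n%:Z m k i)%:Z = \sum_(t \in [set: int])
     ((qbinom K n%:Z (k + t * m%:Z))%:Z - (qbinom K n%:Z (k - i%:Z + t * m%:Z))%:Z).
Proof.
rewrite /middle_index mulr2n => -[kn i0m ikm]; pose N := (n + `|k| + m + 2)%N.
rewrite (@betti_qbinom_sum N) //; try (rewrite /N; lia).
rewrite (@fsbig_int _ N) => [|t tN]; last first.
  have [tN'|tN'] : N%:Z <= t \/ t < - N%:Z by lia.
    have tm : t <= t * m%:Z by nia.
    by rewrite !qbinom_oob //; lia.
  have tm : t * m%:Z <= t by nia.
  by rewrite !qbinom_oob //; lia.
by rewrite big_split sumrN.
Qed.

Lemma sum_even_odd (g : nat -> int) N :
  \sum_(j < N.*2) g j = \sum_(j < N) (g j.*2 + g j.*2.+1).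
Proof.
elim: N => [|N IH]; first by rewrite !big_ord0.
by rewrite doubleS !big_ord_recr /= IH addrA.
Qed.

Lemma betti_euler_char n k i : middle_index m n%:Z k i ->
  (betti K F n%:Z m k i)%:Z = euler_char (seqM K F n%:Z m k i).
Proof.
rewrite /middle_index mulr2n => -[kn i0m ikm]; pose N := (n + `|k| + m + 2)%N.
rewrite (@betti_qbinom_sum N) //; try (rewrite /N; lia).
(* The odd positions of the sequence have degrees k + m - i + t m, one period above k - i + t m. *)
have <- : qbinom_sum N n (k + m%:Z - i%:Z) = qbinom_sum N n (k - i%:Z).
  by rewrite -qbinom_sumB; [congr qbinom_sum; lia | rewrite /N; lia].
pose G (s : int) := (-1) ^+ `|s| * (\dim (term (seqM K F n%:Z m k i) s))%:Z : int.
rewrite /euler_char (@fsbig_int G N.*2) => [|s sN]; last first.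
  rewrite /G /= dim_Mod; set e := if _ then _ else _; set t := (s %/ 2)%Z.
  have e_le : 0 <= e <= m%:Z by rewrite /e; case: ifP => _; lia.
  have [tN|tN] : N%:Z <= t \/ t < - N%:Z by rewrite /t; lia.
    have tm : t <= t * m%:Z by nia.
    by rewrite qbinom_oob ?mulr0 //; lia.
  have tm : t * m%:Z <= t by nia.
  by rewrite qbinom_oob ?mulr0 //; lia.
rewrite -doubleD (sum_even_odd (fun j => G (j%:Z - N.*2%:Z))) -sumrB; apply: eq_bigr => j _.
have -> : j.*2%:Z - N.*2%:Z = 2 * (j%:Z - N%:Z) by lia.
have -> : j.*2.+1%:Z - N.*2%:Z = 2 * (j%:Z - N%:Z) + 1 by lia.
move: (j%:Z - N%:Z) => t.
rewrite /G -[(-1) ^+ `|2 * t|]signr_odd -[(-1) ^+ `|2 * t + 1|]signr_odd /= !dim_Mod.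
have -> : odd `|2 * t| = false by lia.
have -> : odd `|2 * t + 1| by lia.
have -> : (2 %| 2 * t)%Z by lia.
have -> : (2 %| 2 * t + 1)%Z = false by lia.
have -> : (2 * t %/ 2)%Z = t by lia.
have -> : ((2 * t + 1) %/ 2)%Z = t by lia.
rewrite expr0 expr1 mul1r mulN1r addr0; congr (_ - (qbinom _ _ _)%:Z); lia.
Qed.

End Euler.

(** * Betti numbers as polynomials in q *)

(** The parity and the smallest exponent are unchanged, which matches the step by two dimensions in
    the last term of [bettiS]. *)
Lemma lead_expsSS n : lead_exps n.+2 = rcons (lead_exps n) n.+1.
Proof.
case: n => [|[|n]] //; rewrite /lead_exps /lead_eps /= !negbK.
set s := if _ then _ else _; have sn : (s <= n.+2)%N by rewrite /s; case: ifP.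
have -> : index_iota s n.+4 = index_iota s n.+2 ++ [:: n.+2; n.+3].
  rewrite /index_iota (_ : n.+4 - s = n.+2 - s + 2)%N; last by lia.
  by rewrite iotaD /= subnKC.
by rewrite filter_cat /= !negbK eqxx; case: (odd n); rewrite cats1.
Qed.

Definition lead_deg n := (\sum_(e <- lead_exps n) e)%N.
Definition lead_poly n : {poly int} := \prod_(e <- lead_exps n) ('X^e - 1).

Lemma lead_degSS n : lead_deg n.+2 = (lead_deg n + n.+1)%N.
Proof. by rewrite /lead_deg lead_expsSS -cats1 big_cat big_seq1. Qed.

Lemma lead_polySS n : lead_poly n.+2 = ('X^(n.+1) - 1) * lead_poly n.
Proof. by rewrite /lead_poly lead_expsSS -cats1 big_cat big_seq1 mulrC. Qed.

Lemma lead_deg0 : lead_deg 0 = 0%N. Proof. by rewrite /lead_deg big_nil. Qed.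
Lemma lead_deg1 : lead_deg 1 = 0%N. Proof. by rewrite /lead_deg big_nil. Qed.
Lemma lead_poly0 : lead_poly 0 = 1. Proof. by rewrite /lead_poly big_nil. Qed.
Lemma lead_poly1 : lead_poly 1 = 1. Proof. by rewrite /lead_poly big_nil. Qed.

(** The upper bound keeps the terms from one dimension lower strictly below degree [lead_deg n.+2]
    in the recursion. *)
Lemma lead_deg_step n : (lead_deg n <= lead_deg n.+1 <= lead_deg n + n)%N.
Proof.
elim: n => [|n IH]; first by rewrite lead_deg0 lead_deg1.
by rewrite lead_degSS; lia.
Qed.

Lemma size_mul_XnsubC n d (p : {poly int}) : (size p <= d)%N ->
  (size (('X^(n.+1) - 1) * p)%R <= d + n.+1)%N.
Proof.
move=> pd; apply: leq_trans (size_polyMleq _ _) _.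
by rewrite size_XnsubC //= addnC leq_add2r.
Qed.

Lemma size_lead_poly n : (size (lead_poly n) <= (lead_deg n).+1)%N.
Proof.
elim/ltn_ind: n => -[|[|n]] IH; rewrite ?lead_poly0 ?lead_poly1 ?size_poly1 //.
by rewrite lead_polySS lead_degSS -addSn size_mul_XnsubC ?IH.
Qed.

Lemma horner_lead_poly n (x : int) :
  (lead_poly n).[x] = \prod_(e <- lead_exps n) (x ^+ e - 1).
Proof. by rewrite horner_prod; apply: eq_bigr => e _; rewrite !hornerE. Qed.

(** One P, fixed before K and F: this is the sense in which the Betti number is a polynomial in
    q. *)
Definition betti_poly_spec (m n : nat) (k : int) (i : nat) (P : {poly int}) :=
  forall (K : finFieldType) (F : fieldType), #|{: K}|%:R != 0 :> F ->
    is_min_qint_root F #|{: K}| m ->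
  (betti K F n%:Z m k i)%:Z = P.[#|{: K}|%:Z].

(** P comes from the recursion with X in place of q. Its first two terms have degree below
    [lead_deg n], so the top term comes from the third, where 2k - n is unchanged. A size at most d
    means degree less than d. *)
Lemma betti_poly (m n : nat) (k : int) (i : nat) : exists P : {poly int},
  [/\ (size P <= (lead_deg n).+1)%N,
      (0 < i < m)%N -> n%:Z < k + k + m%:Z - i%:Z < n%:Z + m%:Z ->
        `|k + k - n%:Z| <= 1 -> (size (P - lead_poly n)%R <= lead_deg n)%N
    & betti_poly_spec m n k i P].
Proof.
elim/ltn_ind: n k i => n IH k i.
have [i0m|i0m] := boolP (0 < i < m)%N; last first.
  exists 0; split=> [||K F q0 mP]; rewrite ?size_poly0 //.
  by rewrite betti0 // horner0.
case: n IH => [|[|n]] IH.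
- exists (k == 0)%:R; split=> [|_ _ k1|K F q0 mP].
  + by case: (k == 0); rewrite ?size_poly0 ?size_poly1.
  + have -> : k == 0 by lia.
    by rewrite lead_poly0 subrr size_poly0.
  + by rewrite (betti_n0 q0 mP) //; case: (k == 0); rewrite ?horner0 ?hornerC.
- pose b := (((i.+1 < m)%N && (k == 0)) + ((0 < i.-1)%N && (k == 1)))%N.
  have b1 : (b <= 1)%N by rewrite /b; lia.
  exists b%:R; split=> [|_ kn k1|K F q0 mP].
  + by rewrite -polyC_natr (leq_trans (size_polyC_leq1 _)).
  (* Here k is 0 or 1, and the middle condition makes exactly one of the two summands equal to 1. *)
  + have -> : b = 1%N by rewrite /b; lia.
    by rewrite lead_poly1 subrr size_poly0.
  + have E1 : betti K F 0%:Z m k i.+1 = (i.+1 < m)%N && (k == 0).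
      by have [im|im] := boolP (i.+1 < m)%N; [rewrite (betti_n0 q0 mP)|rewrite betti0].
    have E2 : betti K F 0%:Z m (k - 1) i.-1 = (0 < i.-1)%N && (k == 1).
      have [im|im] := boolP (0 < i.-1)%N; last by rewrite betti0 // (negPf im).
      by rewrite (betti_n0 q0 mP) ?subr_eq0 //; lia.
    by rewrite -polyC_natr hornerC (bettiS q0 mP) // expn0 subnn muln0 addn0 E1 E2 natz.
have [P1 [P1s _ P1E]] := IH n.+1 (ltnSn _) k i.+1.
have [P2 [P2s _ P2E]] := IH n.+1 (ltnSn _) (k - 1) i.-1.
have [P3 [P3s P3l P3E]] := IH n (leqnSn _) (k - 1) i.
have d1 := lead_deg_step n; have d2 := lead_deg_step n.+1.
have P12 : (size (P1 + P2)%R <= lead_deg n.+2)%N.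
  by apply: leq_trans (size_polyD _ _) _; rewrite lead_degSS; lia.
exists (P1 + P2 + ('X^(n.+1) - 1) * P3); split=> [|_ kn k1|K F q0 mP].
- apply: leq_trans (size_polyD _ _) _; rewrite geq_max (leq_trans P12) //=.
  by rewrite lead_degSS -addSn size_mul_XnsubC.
- rewrite lead_polySS -addrA -mulrBr; apply: leq_trans (size_polyD _ _) _.
  rewrite geq_max P12 /= lead_degSS size_mul_XnsubC //; apply: P3l => //; lia.
rewrite (bettiS q0 mP) // !PoszD PoszM P1E // P2E // P3E // !hornerE.
rewrite [in RHS]mulrC; congr (_ + _ * _); rewrite -subzn.
  by rewrite -[in LHS]natz natrX natz.
by rewrite expn_gt0; apply/orP; left; apply/card_gt0P; exists 0.
Qed.

Theorem theorem4p5 (m n : nat) (k : int) (i : nat)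
    (hki : middle_index m n%:Z k i) :
  (forall (K : finFieldType) (F : fieldType) (p : nat),
     p \in [pchar F] -> ~~ (p %| #|{: K}|)%N ->
     is_min_qint_root F #|{: K}| m ->
     [/\ (1 <= n)%N ->
         betti K F n%:Z m k i =
           (betti K F (n%:Z - 1) m k i.+1 + betti K F (n%:Z - 1) m (k - 1) i.-1
            + betti K F (n%:Z - 2) m (k - 1) i * (#|{: K}| ^ (n - 1) - 1))%N,
         (betti K F n%:Z m k i)%:Z =
           \sum_(t \in [set: int])
             ((qbinom K n%:Z (k + t * m%:Z))%:Z
              - (qbinom K n%:Z (k - i%:Z + t * m%:Z))%:Z),
         (betti K F n%:Z m k i)%:Z = euler_char (seqM K F n%:Z m k i) &
         forall l j : nat, (l <= n)%N -> (0 < j < m)%N ->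
           betti K F n%:Z m l%:Z j = betti K F n%:Z m (n%:Z - l%:Z) (m - j)])
  /\
  (exists f : {poly int},
     [/\ (size f <= (\sum_(e <- lead_exps n) e).+1)%N,
         `|k *+ 2 - n%:Z| <= 1 -> (size f <= \sum_(e <- lead_exps n) e)%N &
         forall (K : finFieldType) (F : fieldType) (p : nat),
           p \in [pchar F] -> ~~ (p %| #|{: K}|)%N ->
           is_min_qint_root F #|{: K}| m ->
           (betti K F n%:Z m k i)%:Z =
             \prod_(e <- lead_exps n) (#|{: K}|%:Z ^+ e - 1)
             + f.[#|{: K}|%:Z]]).
Proof.
have [_ i0m ikm] := hki; rewrite mulr2n in ikm *; split.
  move=> K F p pF; rewrite (dvdn_pcharf pF) => q0 mP; split.
  - case: n {hki ikm} => // n _; rewrite (bettiS q0 mP) // subSS subn0.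
    rewrite (_ : n.+1%:Z - 1 = n%:Z); last by lia.
    (* For n = 1 the dimension n - 2 is -1, while [bettiS] truncates it to 0; the factor q^0 - 1 = 0
       removes both terms. *)
    case: n => [|n]; first by rewrite expn0 subnn !muln0.
    by rewrite (_ : n.+2%:Z - 2 = n%:Z); last by lia.
  - by rewrite (betti_euler (min_root_gt1 mP) q0 mP hki).
  - by rewrite (betti_euler_char (min_root_gt1 mP) q0 mP hki).
  - by move=> l j _ /andP[_ /ltnW jm]; apply: (betti_duality q0 mP).
have [P [Ps Pl PE]] := betti_poly m n k i.
exists (P - lead_poly n); split.
- apply: leq_trans (size_polyD _ _) _; rewrite size_polyN geq_max Ps.
  exact: size_lead_poly.
- exact: Pl.
move=> K F p pF; rewrite (dvdn_pcharf pF) => q0 mP.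
by rewrite (PE K F q0 mP) hornerD hornerN horner_lead_poly addrC subrK.
Qed.
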